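(* Let $\mu$ be a nontrivial probability measure on the unit circle $\mathcal{C}$ such that the principal value integral $I=\mathrm{p.v.}\!\int_{\mathcal{C}}\zeta(\zeta-1)^{-1}\,d\mu(\zeta)$ exists, and let $\{S_n\}$ be the sequence of monic OPUC with respect to $\mu$. Let $-\infty<t<\infty$ and let the sequence $\{\rho_n(t)\}_{n=0}^{\infty}$, with the property $|\rho_n(t)|=1$, be given by $$\rho_0(t)=-\frac{I+it}{\overline{I}-it}\quad\text{and}\quad \rho_n(t)=\frac{\rho_{n-1}(t)-\overline{\alpha}_{n-1}}{1-\rho_{n-1}(t)\alpha_{n-1}},\qquad n\ge1,$$ where $\alpha_{n-1}=-\overline{S_n(0)}$, $n\ge0$ (in particular $\alpha_{-1}=-1$). Then for the sequence $\{R_n(t;z)\}$ of para-orthogonal polynomials in $z$ given by $$R_n(t;z)\prod_{k=0}^{n-1}\frac{1+\operatorname{Re}(\rho_k(t)\alpha_{k-1})}{1+\overline{\rho_k(t)\alpha_{k-1}}}=zS_{n-1}(z)-\rho_{n-1}(t)S_{n-1}^{*}(z),\qquad n\ge1,$$ the following three term recurrence formula holds for $n\ge1$: $$R_{n+1}(t;z)=\big[(1+ic_{n+1}(t))z+(1-ic_{n+1}(t))\big]R_n(t;z)-4d_{n+1}(t)\,z\,R_{n-1}(t;z),$$ with $R_0(t;z)=1$ and $R_1(t;z)=(1+ic_1(t))z+(1-ic_1(t))$, where the real sequences $\{c_n(t)\}$ and $\{d_{n+1}(t)\}$ are such that $$c_1(t)=i\,\frac{\rho_0(t)+1}{\rho_0(t)-1}=-2\big(t+\operatorname{Im}(I)\big)$$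 and $$c_{n+1}(t)=\frac{-\operatorname{Im}(\rho_n(t)\alpha_{n-1})}{1+\operatorname{Re}(\rho_n(t)\alpha_{n-1})},\qquad d_{n+1}(t)=(1-\mathfrak{m}_{n-1}(t))\mathfrak{m}_n(t),\qquad n\ge1,$$ where $\{\mathfrak{m}_n(t)\}_{n=0}^{\infty}$ is the minimal parameter sequence of the positive chain sequence $\{d_{n+1}(t)\}_{n=1}^{\infty}$, given by $$\mathfrak{m}_n(t)=\frac12\,\frac{1-|\rho_n(t)\alpha_{n-1}|^2}{1+\operatorname{Re}(\rho_n(t)\alpha_{n-1})},\qquad n\ge0.$$ The sequence $\{d_{n+1}(t)\}_{n=1}^{\infty}$ is always a SPPCS (single parameter positive chain sequence) if $t\ne0$. However, $\{d_{n+1}(0)\}_{n=1}^{\infty}$ is not a SPPCS if and only if the integral $J=\int_{\mathcal{C}}\zeta(\zeta-1)^{-1}(1-\zeta)^{-1}\,d\mu(\zeta)$ exists. With respect to the measure $\mu$, the polynomials $R_n(t;z)$ satisfy the L-orthogonality $$\mathcal{N}^{(t)}\big[z^{-n+k}R_n(t;z)\big]=0,\qquad k=0,1,\dots,n-1,$$ with respect to the moment functional $\mathcal{N}^{(t)}$ on Laurent polynomials $\ell$ given by $$\frac{1+4(t+\operatorname{Im}(I))^2}{4d_1}\,\mathcal{N}^{(t)}[\ell(z)]=\mathrm{p.v.}\!\int_{\mathcal{C}}\ell(\zeta)\frac{\zeta}{\zeta-1}\,d\mu(\zeta)+i\,t\,\ell(1),$$ where $d_1$ is an arbitrary nonzero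 real number.
   Context: $\mathcal{C}=\{\zeta\in\mathbb{C}:|\zeta|=1\}$. A measure on $\mathcal{C}$ is nontrivial if its support is infinite. The monic orthogonal polynomials on the unit circle (OPUC) of $\mu$ are the monic polynomials $S_n$ of degree $n$ with $\int_{\mathcal{C}}\overline{S_m}S_n\,d\mu=0$ for $m\ne n$; $S_n^{*}(z)=z^n\overline{S_n(1/\bar z)}$. The principal value integral is $\mathrm{p.v.}\!\int_{\mathcal{C}}f(\zeta)\,d\mu(\zeta)=\lim_{\epsilon\to0^+}\int_{\epsilon}^{2\pi-\epsilon}f(e^{i\theta})\,d\mu(e^{i\theta})$. Positive chain sequence: a sequence $\{a_n\}_{n=1}^{\infty}$ is a positive chain sequence if there is a parameter sequence $\{g_n\}_{n=0}^{\infty}$ with $0\le g_0<1$, $0<g_n<1$ for $n\ge1$ and $a_n=(1-g_{n-1})g_n$ for $n\ge1$. The minimal parameter sequence is the one with $g_0=0$; the maximal parameter sequence is the one with largest $g_0$. A positive chain sequence is a SPPCS if its minimal and maximal parameter sequences coincide. On $\mathcal{C}\setminus\{1\}$, $\zeta(\zeta-1)^{-1}(1-\zeta)^{-1}=|\zeta-1|^{-2}$; ''$J$ exists'' means the integral is finite.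
   Formalization: The formal theorem adds the hypothesis μ({1})=0; with an atom at 1 the claim is false (for μ=(δ_1+normalized arc length)/2 and t=1, the first expression for c_1 is −4 and the second −2), and the L-orthogonality at n=2 always fails. *)

(* Defs.v *)
From HB Require Import structures.
From mathcomp Require Import all_boot all_order all_algebra.
From mathcomp Require Import complex.
From mathcomp Require Import all_classical all_reals all_analysis.

Set Implicit Arguments.
Unset Strict Implicit.
Unset Printing Implicit Defensive.

Import Order.TTheory GRing.Theory Num.Theory.
Import numFieldNormedType.Exports.

Local Open Scope classical_set_scope.
Local Open Scope complex_scope.
Local Open Scope ring_scope.

(* The topology of the complex plane is only inferred through the alias
   [R[i]^o]; its Borel sigma-algebra is generated by the open sets. *)
Definition borelC (R : realType) := g_sigma_algebraType (@open (R[i]^o)).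

Definition unit_circle (R : realType) : set R[i] := [set z | `|z| = 1].

(* Closed support, in the plane. *)
Definition msupport (R : realType) (mu : probability (borelC R) R) :
    set R[i] :=
  [set z | forall U : set R[i]^o, open U -> U z -> (0 < mu U)%E].

Definition nontrivial (R : realType) (mu : probability (borelC R) R) :=
  infinite_set (msupport mu).

Definition cintegrable (R : realType) (mu : probability (borelC R) R)
    (D : set R[i]) (f : R[i] -> R[i]) : Prop :=
  mu.-integrable D (fun z : borelC R => (complex.Re (f z))%:E) /\
  mu.-integrable D (fun z : borelC R => (complex.Im (f z))%:E).

Definition cintegral (R : realType) (mu : probability (borelC R) R)
    (D : set R[i]) (f : R[i] -> R[i]) : R[i] :=
  (\int[mu]_(z in D) complex.Re (f z))%R +i*
  (\int[mu]_(z in D) complex.Im (f z))%R.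

Definition arc (R : realType) (eps : R) : set R[i] :=
  [set (cos x +i* sin x) | x in `[eps, 2 * pi - eps]].

Definition pv_trunc (R : realType) (mu : probability (borelC R) R)
    (f : R[i] -> R[i]) (eps : R) : R[i]^o :=
  cintegral mu (arc eps) f.

Definition pv_exists (R : realType) (mu : probability (borelC R) R)
    (f : R[i] -> R[i]) : Prop :=
  cvg (pv_trunc mu f eps @[eps --> 0^'+]).

(* Meaningful only under [pv_exists mu f]. *)
Definition pv_integral (R : realType) (mu : probability (borelC R) R)
    (f : R[i] -> R[i]) : R[i] :=
  lim (pv_trunc mu f eps @[eps --> 0^'+]).

Definition monic_opuc (R : realType) (mu : probability (borelC R) R)
    (S : nat -> {poly R[i]}) : Prop :=
  (forall n, S n \is monic /\ size (S n) = n.+1) /\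
  (forall m n, m <> n ->
     cintegral mu (@unit_circle R) (fun z => ((S m).[z])^* * (S n).[z]) = 0).

(* The polynomial z^n * conj (p (1 / conj z)) for p of degree at most n;
   see [horner_revpoly]. *)
Definition revpoly (R : realType) (n : nat) (p : {poly R[i]}) : {poly R[i]} :=
  \poly_(i < n.+1) (p`_(n - i))^*.

Lemma horner_revpoly (R : realType) (n : nat) (p : {poly R[i]}) (z : R[i]) :
  (size p <= n.+1)%N -> z != 0 ->
  (revpoly n p).[z] = z ^+ n * (p.[1 / z^*])^*.
Proof.
move=> sp z0.
rewrite /revpoly horner_poly (horner_coef_wide _ sp) rmorph_sum mulr_sumr.
rewrite (reindex_inj rev_ord_inj) /=; apply: eq_bigr => i _.
have lein : (i <= n)%N by rewrite -ltnS.
have zV : (1 / z^*)^* = z^-1 by rewrite div1r fmorphV /= conjCK.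
rewrite subSS subKn // rmorphM rmorphXn /= zV mulrCA; congr (_ * _).
by rewrite exprVn -expfB_cond ?(negPf z0).
Qed.

(* Verblunsky coefficients with the index shifted by one: [verb S n] is
   alpha_(n-1) = - conj (S_n(0)), so that [verb S 0] is alpha_(-1) = -1. *)
Definition verb (R : realType) (S : nat -> {poly R[i]}) (n : nat) : R[i] :=
  - ((S n).[0])^*.

(* Chain sequences are indexed from 1: the value [a 0] is never used. *)
Definition is_param_seq (R : realType) (a g : nat -> R) : Prop :=
  [/\ 0 <= g 0%N < 1,
      forall n, (1 <= n)%N -> 0 < g n < 1 &
      forall n, (1 <= n)%N -> a n = (1 - g n.-1) * g n].

Definition positive_chain (R : realType) (a : nat -> R) : Prop :=
  exists g, is_param_seq a g.

Definition is_min_param (R : realType) (a g : nat -> R) : Prop :=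
  is_param_seq a g /\ g 0%N = 0.

Definition is_max_param (R : realType) (a g : nat -> R) : Prop :=
  is_param_seq a g /\ (forall h, is_param_seq a h -> h 0%N <= g 0%N).

Definition sppcs (R : realType) (a : nat -> R) : Prop :=
  exists g, is_min_param a g /\ is_max_param a g.

(* Only the values away from 0 matter, as for Laurent polynomials. *)
Definition laurent_poly (R : realType) (l : R[i] -> R[i]) : Prop :=
  exists (p : {poly R[i]}) (m : nat),
    forall z, z != 0 -> l z = p.[z] / z ^+ m.

(* Main.v *)
(* Write k(z) = z/(z-1), I for its principal value, w = I + i t, and let L map a
   polynomial p to the principal value of p k plus i t p(1). On the circle
   conj(k) = 1 - k, so Re w = 1/2 and W_n = L(S_n) satisfies
   W_(n+1) = W_n + conj(alpha_n) conj(W_n). Hence rho_n = - W_n / conj(W_n),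
   which gives |rho_n| = 1 and the L-orthogonality, while the recurrence is
   algebra on the Szego recursion.
   Put s_n = |W_n|^2 / ||S_n||^2. Then m_n / (1 - m_n) = s_n / s_(n-1), and by
   Wall's criterion the chain sequence is a SPPCS iff sum s_n diverges. If the
   sum is finite then L is bounded in L^2(mu) on polynomials; for
   D_n = 1 + ... + z^(n-1) one has Re L(D_n) = ||D_n||^2 / 2, so the norms of the
   D_n are bounded, and averaging over n shows that 1/|z-1|^2 is integrable,
   i.e. that k lies in L^2(mu). Then t D_n(1) = t n stays bounded as well, which
   forces t = 0. Conversely, when t = 0 and J is finite, Bessel's inequality for
   k bounds sum s_n by J. *)

Require Import Defs.
From HB Require Import structures.
From mathcomp Require Import all_boot all_order all_algebra.
From mathcomp Require Import complex.
From mathcomp Require Import all_classical all_reals all_analysis.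
From mathcomp Require Import measurable_realfun.
From mathcomp Require Import ring lra.

Set Implicit Arguments.
Unset Strict Implicit.
Unset Printing Implicit Defensive.

Import Order.TTheory GRing.Theory Num.Theory.
Import numFieldNormedType.Exports.

Local Open Scope classical_set_scope.
Local Open Scope complex_scope.
Local Open Scope ring_scope.

(** * Chain sequences *)

(** Each [s_n] is the squared modulus of L on the normalised [S_n], so the sum of the [s_n] is the
    squared norm of L on polynomials. This is why a finite sum means boundedness, and why Bessel's
    inequality bounds it when k represents L. Only k itself needs a principal value: on the circle p
    k differs from p(1) k by the bounded function z (p - p(1)) / (z - 1), so L(p) is p(1) w plus an
    ordinary integral, and the rest is algebra. The truncations never see the point 1; as it carries
    no mass, they recover the ordinary integral of a bounded function, and identities under the
    integral may be checked after division by z - 1. The averages over n are needed because |D_n|^2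
    |z - 1|^2 = 2 - 2 Re z^n oscillates, whereas its means converge to 2 off 1. Bounds on L are
    stated in the form of Young's inequality, with a unimodular factor that selects a direction;
    everything stays quadratic and no square root of a norm appears. *)

Lemma min_param_bounds (R : realType) (a m : nat -> R) (n : nat) :
  is_min_param a m -> 0 <= m n < 1.
Proof.
case=> -[m0 mn _] _; case: n => [//|n].
by have /andP[/ltW -> ->] := mn n.+1 isT.
Qed.

(* Wall's criterion. For another parameter sequence [h] with [h 0 > 0] the numbers
   [y n = (1 - m n) / (h n - m n) > 1] satisfy
   [y (n-1) = 1 + y n * m n / (1 - m n)], so the partial sums of [s] stay
   below [s 0 * y 0]; conversely, when they are bounded this relation can be
   solved for [y], which yields such an [h]. *)
Lemma sppcs_divergent_sum (R : realType) (a m s : nat -> R) :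
  is_min_param a m -> (forall n, 0 < s n) ->
  (forall n, m n.+1 * s n = (1 - m n.+1) * s n.+1) ->
  sppcs a <-> ~ (exists C, forall n, \sum_(k < n) s k <= C).
Proof.
move=> am s_gt0 ms; have mb n := min_param_bounds n am.
have [[_ mpos ma] m0] := am.
split=> [[g [[_ g0] [_ gmax]]] [C sC]|nbnd].
(* [Y n] stands for [s n * y n], for which the relation becomes [Y n = Y n.+1 + s n]. The added 1
   gives [s n < Y n], that is [h n < 1]. *)
- pose Y n := C + 1 - \sum_(k < n) s k.
  have Ys n : s n < Y n.
    by have := sC n.+1; rewrite /Y big_ord_recr /=; lra.
  have Y_gt0 n : 0 < Y n by exact: lt_trans (Ys n).
  have YS n : Y n = Y n.+1 + s n by rewrite /Y big_ord_recr /=; ring.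
  pose h n := m n + (1 - m n) * (s n / Y n).
  have h_gt0 n : 0 < h n.
    have q : 0 < s n / Y n by rewrite divr_gt0.
    have /andP[mn0 mn1] := mb n.
    by apply: ltr_wpDl => //; apply: mulr_gt0; rewrite ?subr_gt0.
  have h_lt1 n : h n < 1.
    have q : s n / Y n < 1 by rewrite ltr_pdivrMr ?mul1r.
    have /andP[mn0 mn1] := mb n.
    rewrite -subr_gt0 /h (_ : _ - _ = (1 - m n) * (1 - s n / Y n)); last ring.
    by rewrite mulr_gt0 ?subr_gt0.
  have /gmax : is_param_seq a h.
    split=> [|n _|[//|n] _]; rewrite ?h_lt1 ?h_gt0 ?(ltW (h_gt0 _)) //=.
    rewrite ma //= /h.
    have -> : (1 - m n.+1) * (s n.+1 / Y n.+1) = m n.+1 * (s n / Y n.+1).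
      by rewrite [LHS]mulrA -(ms n) -mulrA.
    have Yn0 := lt0r_neq0 (Y_gt0 n); have Yn1 := lt0r_neq0 (Y_gt0 n.+1).
    by move: Yn0; rewrite (YS n) => Yn0; field; rewrite Yn0 Yn1.
  by rewrite g0 leNgt h_gt0.
- exists m; split=> //; split=> [//|h [h0 hn ha]].
  rewrite m0 leNgt; apply/negP => h0_gt0; apply: nbnd.
  have h_lt1 n : h n < 1.
    by case: n => [|n]; [case/andP: h0|case/andP: (hn n.+1 isT)].
  exists (s 0%N / h 0%N) => n.
  (* The relation for y in telescoped form: the partial sum plus [s n * y n] does not depend on
     n. *)
  have [hm K] : m n < h n /\
      \sum_(k < n) s k + (1 - m n) * s n / (h n - m n) = s 0%N / h 0%N.
    elim: n => [|n [hm K]]; first by rewrite m0 big_ord0 !subr0 mul1r add0r.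
    have e : (h n.+1 - m n.+1) * (1 - h n) = m n.+1 * (h n - m n).
      by have := ha n.+1 isT; rewrite ma //= => e; lra.
    have /andP[mS0 mS1] := mpos n.+1 isT.
    have hmS : 0 < h n.+1 - m n.+1.
      by rewrite -(pmulr_lgt0 _ (_ : 0 < 1 - h n)) ?subr_gt0 // e mulr_gt0
        ?subr_gt0.
    split; first by rewrite -subr_gt0.
    rewrite -K big_ord_recr /= -ms -addrA; congr (_ + _).
    have d0 : h n - m n != 0 by rewrite gt_eqF ?subr_gt0.
    have d1 := lt0r_neq0 hmS; have mSn := lt0r_neq0 mS0.
    have em : m n.+1 = (h n.+1 - m n.+1) * (1 - h n) / (h n - m n).
      by rewrite e mulfK.
    move: (h n.+1 - m n.+1) d1 em => x x0 ->.
    by field; rewrite x0 d0.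
  rewrite -K lerDl divr_ge0 ?mulr_ge0 ?subr_ge0 ?(ltW hm) ?(ltW (s_gt0 _)) //.
  by case/andP: (mb n) => _ /ltW.
Qed.

(** With [U], [V] the n-th orthogonal polynomial and its reversal, one Szego step is already
    substituted on both sides. The three scalar conditions match the coefficients of X U, X V and
    V. *)
Lemma para_orthogonal_recurrence (F : fieldType) (U V : {poly F})
    (r r' k s al alb : F) :
  r' * al = k - s -> (1 - s) * r = alb -> k * r = r' ->
  'X * ('X * U - alb *: V) - r' *: (V - al *: ('X * U)) =
  ('X + k%:P) * ('X * U - r *: V) - s *: ('X * (U - r *: V)).
Proof.
move=> e1 <- krr; rewrite -krr in e1 *.
rewrite [X in _ - X]scalerBr scalerA e1 -!mul_polyC.
rewrite !rmorphM !rmorphB /= rmorph1; ring.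
Qed.

(** * Complex numbers: limits and measurability *)

Lemma conjcE (R : realType) (z : R[i]) :
  z^* = complex.Re z +i* - complex.Im z.
Proof. by case: z. Qed.

Lemma complex_ext (R : realType) (z w : R[i]) :
  complex.Re z = complex.Re w -> complex.Im z = complex.Im w -> z = w.
Proof. by case: z w => [a b] [c d] /= -> ->. Qed.

Lemma ReD (R : realType) (z w : R[i]) :
  complex.Re (z + w) = complex.Re z + complex.Re w.
Proof. by case: z w => [a b] [c d]. Qed.

Lemma ImD (R : realType) (z w : R[i]) :
  complex.Im (z + w) = complex.Im z + complex.Im w.
Proof. by case: z w => [a b] [c d]. Qed.

Lemma ReN (R : realType) (z : R[i]) : complex.Re (- z) = - complex.Re z.
Proof. by case: z. Qed.

Lemma ImN (R : realType) (z : R[i]) : complex.Im (- z) = - complex.Im z.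
Proof. by case: z. Qed.

Lemma ReM (R : realType) (z w : R[i]) : complex.Re (z * w) =
  complex.Re z * complex.Re w - complex.Im z * complex.Im w.
Proof. by case: z w => [a b] [c d]. Qed.

Lemma ImM (R : realType) (z w : R[i]) : complex.Im (z * w) =
  complex.Re z * complex.Im w + complex.Im z * complex.Re w.
Proof. by case: z w => [a b] [c d]. Qed.

Lemma ReJ (R : realType) (z : R[i]) : complex.Re z^* = complex.Re z.
Proof. by case: z. Qed.

Lemma ImJ (R : realType) (z : R[i]) : complex.Im z^* = - complex.Im z.
Proof. by case: z. Qed.

Lemma Re_mulJ (R : realType) (z : R[i]) :
  complex.Re (z * z^*) = complex.Re z ^+ 2 + complex.Im z ^+ 2.
Proof. by rewrite ReM ReJ ImJ mulrN opprK -!expr2. Qed.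

Lemma normr_Im_le (R : realType) (z : R[i]) : `|complex.Im z|%:C <= `|z|.
Proof.
case: z => a b; rewrite normc_def lecR /= -sqrtr_sqr ler_sqrt.
  by rewrite lerDr sqr_ge0.
by rewrite addr_ge0 ?sqr_ge0.
Qed.

Lemma normc_le_ReIm (R : realType) (z : R[i]) :
  `|z| <= (`|complex.Re z| + `|complex.Im z|)%:C.
Proof.
rewrite normc_def lecR -[leRHS]ger0_norm ?addr_ge0 // -sqrtr_sqr.
rewrite ler_sqrt ?sqr_ge0 //.
rewrite sqrrD !real_normK ?num_real // -addrA lerD2l lerDr.
by rewrite mulrn_wge0 // mulr_ge0.
Qed.

Section complex_limits.
Context (R : realType) (T : Type) (F : set_system T) (FF : Filter F).
Implicit Types (f : T -> R[i]^o) (l : R[i]).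

Lemma cvg_Re f l : f @ F --> (l : R[i]^o) ->
  (complex.Re (f x) : R^o) @[x --> F] --> (complex.Re l : R^o).
Proof.
move=> /cvgrPdist_lt fl; apply/cvgrPdist_lt => e e0.
have /fl : 0 < e%:C :> R[i] by rewrite ltcR.
apply: filterS => x; rewrite -ltcR -ReN -ReD.
exact: le_lt_trans (normc_ge_Re _).
Qed.

Lemma cvg_Im f l : f @ F --> (l : R[i]^o) ->
  (complex.Im (f x) : R^o) @[x --> F] --> (complex.Im l : R^o).
Proof.
move=> /cvgrPdist_lt fl; apply/cvgrPdist_lt => e e0.
have /fl : 0 < e%:C :> R[i] by rewrite ltcR.
apply: filterS => x; rewrite -ltcR -ImN -ImD.
exact: le_lt_trans (normr_Im_le _).
Qed.

Lemma cvg_complex f l :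
  (complex.Re (f x) : R^o) @[x --> F] --> (complex.Re l : R^o) ->
  (complex.Im (f x) : R^o) @[x --> F] --> (complex.Im l : R^o) ->
  f @ F --> (l : R[i]^o).
Proof.
move=> /cvgrPdist_lt fR /cvgrPdist_lt fI; apply/cvgrPdist_lt => e.
rewrite ltcE => /andP[/eqP /= e_im e0].
have e2 : 0 < complex.Re e / 2 by rewrite divr_gt0.
near=> x; apply: le_lt_trans (normc_le_ReIm _) _.
rewrite ltcE /= e_im eqxx /= !(ReD, ImD, ReN, ImN) [ltRHS]splitr.
by rewrite ltrD //; near: x; [exact: fR|exact: fI].
Unshelve. all: by end_near. Qed.

End complex_limits.

Lemma Re_measurable (R : realType) (D : set R[i]) :
  measurable (D : set (borelC R)) ->
  measurable_fun (D : set (borelC R)) (@complex.Re R : borelC R -> R).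
Proof.
move=> mD; apply: measurable_funTS.
apply: (measurability _ (RGenOpens.measurableE R)) => _ [_ [a [b ->]] <-].
rewrite setTI; apply: sub_sigma_algebra.
rewrite -[X in open X]/((@complex.Re R : R[i]^o -> R^o) @^-1` `]a, b[%classic).
apply: open_comp; last exact: interval_open.
by move=> x _; exact: (@cvg_Re R _ (nbhs (x : R[i]^o)) _ id x).
Qed.

Lemma Im_measurable (R : realType) (D : set R[i]) :
  measurable (D : set (borelC R)) ->
  measurable_fun (D : set (borelC R)) (@complex.Im R : borelC R -> R).
Proof.
move=> mD; apply: measurable_funTS.
apply: (measurability _ (RGenOpens.measurableE R)) => _ [_ [a [b ->]] <-].
rewrite setTI; apply: sub_sigma_algebra.
rewrite -[X in open X]/((@complex.Im R : R[i]^o -> R^o) @^-1` `]a, b[%classic).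
apply: open_comp; last exact: interval_open.
by move=> x _; exact: (@cvg_Im R _ (nbhs (x : R[i]^o)) _ id x).
Qed.

Lemma horner_continuous_complex (R : realType) (p : {poly R[i]}) :
  continuous (fun z : R[i]^o => p.[z] : R[i]^o).
Proof.
elim/poly_ind: p => [|p c IH] x.
  by under eq_fun do rewrite horner0; exact: cst_continuous.
under eq_fun do rewrite hornerMXaddC.
apply: (@cvgD _ R[i]^o _ (nbhs (x : R[i]^o)) _ (fun z => p.[z] * z)).
  apply: (@cvgM R[i] _ (nbhs (x : R[i]^o)) _ (horner p) id); first exact: IH.
  exact: (@cvg_id _ (nbhs (x : R[i]^o))).
exact: (@cvg_cst R[i]^o).
Qed.

(** Inversion is continuous only off 0; the single point 0 is split off. *)
Lemma invr_measurable (R : realType) : measurable_fun setT (@GRing.inv R).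
Proof.
have -> : setT = [set x : R | x != 0] `|` [set 0].
  by apply/seteqP; split=> x // _; have [->|x0] := eqVneq x 0; [right|left].
have o : open [set x : R | x != 0] by exact: open_neq.
apply/measurable_funU => //; first exact: open_measurable.
split; last first.
  by move=> _ Y mY; have [h|h] := pselect (Y (0 : R)^-1);
  [rewrite (_ : _ `&` _ = [set 0])//|rewrite (_ : _ `&` _ = set0)//];
  apply/seteqP; split=> x //=; [case|move=> ->; split|case=> ->].
apply: open_continuous_measurable_fun => // x; rewrite inE => x0.
exact: inv_continuous.
Qed.

(** * The unit circle *)

Lemma circleP (R : realType) (z : R[i]) :
  unit_circle z <-> complex.Re z ^+ 2 + complex.Im z ^+ 2 = 1.
Proof.
rewrite /unit_circle /= normc_def; split=> [[zE]|->]; last by rewrite sqrtr1.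
by rewrite -[LHS]sqr_sqrtr ?zE ?expr1n // addr_ge0 ?sqr_ge0.
Qed.

Lemma circle_Re (R : realType) (z : R[i]) :
  unit_circle z -> `|complex.Re z| <= 1.
Proof.
by rewrite /unit_circle /= => z1; rewrite -lecR (le_trans (normc_ge_Re z)) ?z1.
Qed.

Lemma circle_Im (R : realType) (z : R[i]) :
  unit_circle z -> `|complex.Im z| <= 1.
Proof.
by rewrite /unit_circle /= => z1; rewrite -lecR (le_trans (normr_Im_le z)) ?z1.
Qed.

Lemma circle_neq0 (R : realType) (z : R[i]) : unit_circle z -> z != 0.
Proof. by rewrite /unit_circle /= -normr_eq0 => ->; rewrite oner_eq0. Qed.

Lemma circle_mulJ (R : realType) (z : R[i]) : unit_circle z -> z * z^* = 1.
Proof. by rewrite /unit_circle /= -normCK => ->; rewrite expr1n. Qed.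

Lemma circle_inv (R : realType) (z : R[i]) : unit_circle z -> z^-1 = z^*.
Proof.
move=> Tz; apply: (mulfI (circle_neq0 Tz)).
by rewrite circle_mulJ // divff ?circle_neq0.
Qed.

Lemma circle_Re_lt1 (R : realType) (z : R[i]) :
  unit_circle z -> z != 1 -> complex.Re z < 1.
Proof.
move=> Tz z1; rewrite lt_neqAle (le_trans (ler_norm _) (circle_Re Tz)) andbT.
apply: contraNneq z1 => rz; have /circleP := Tz.
rewrite rz expr1n -[RHS]addr0 => /addrI/eqP; rewrite sqrf_eq0 => /eqP iz.
by apply/eqP/complex_ext.
Qed.

Lemma measurable_circle (R : realType) :
  measurable (@unit_circle R : set (borelC R)).
Proof.
have -> : @unit_circle R = setT `&`
    (fun z : borelC R => complex.Re z ^+ 2 + complex.Im z ^+ 2) @^-1` [set 1].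
  by apply/seteqP; split=> z; rewrite setTI => /circleP.
suff mf : measurable_fun setT
    (fun z : borelC R => complex.Re z ^+ 2 + complex.Im z ^+ 2) by exact: mf.
by apply: measurable_funD; apply: measurable_funX;
   [exact: Re_measurable|exact: Im_measurable].
Qed.
#[local] Hint Extern 0 (measurable (@unit_circle _)) =>
  exact: measurable_circle : core.

Lemma ler_cos (R : realType) :
  {in `[0, pi] &, {mono (@cos R) : x y /~ y <= x}}.
Proof. by move=> x y x0 y0; rewrite !leNgt ltr_cos. Qed.

(** Trades the parametrisation for a half-plane, from which measurability of the arc and its
    distance from 1 are read off. Points of the lower half have the angle 2 pi - acos (Re z). *)
Lemma arcE (R : realType) (eps : R) : 0 < eps <= pi ->
  Defs.arc eps = @unit_circle R `&` [set z | complex.Re z <= cos eps].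
Proof.
move=> /andP[e0 epi]; apply/seteqP; split=> [z [x /= + <-]|z [Tz /= zc]].
  rewrite in_itv /= => /andP[ex xe]; split.
    by apply/circleP; rewrite cos2Dsin2.
  rewrite /=; have [xpi|pix] := leP x pi.
    by rewrite ler_cos // in_itv /= ?(ltW e0) ?(le_trans (ltW e0)).
  have -> : cos x = cos (2 * pi - x).
    by rewrite mulr_natl cosB cos2pi sin2pi mul1r mul0r addr0.
  rewrite ler_cos ?in_itv /= ?(ltW e0) //; lra.
have /circleP Tz2 := Tz; have := circle_Re Tz; rewrite ler_norml => Rz.
pose x := acos (complex.Re z).
have x0 : 0 <= x by exact: acos_ge0.
have xpi : x <= pi by exact: acos_lepi.
have cx : cos x = complex.Re z by rewrite acosK // in_itv.
have ex : eps <= x.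
  by rewrite -ler_cos ?in_itv /= ?cx ?x0 ?(ltW e0) ?xpi.
have sx : sin x = `|complex.Im z|.
  by rewrite /x sin_acos // -Tz2 addrC addKr sqrtr_sqr.
have [i0|i0] := leP 0 (complex.Im z).
  exists x; first by rewrite /= in_itv /= ex; lra.
  by apply: complex_ext; rewrite //= sx ger0_norm.
exists (2 * pi - x); first by rewrite /= in_itv /=; lra.
apply: complex_ext => /=.
  by rewrite mulr_natl cosB cos2pi sin2pi mul1r mul0r addr0.
rewrite mulr_natl sinB cos2pi sin2pi mul1r mul0r sub0r sx.
by rewrite ltr0_norm // opprK.
Qed.

Lemma arc_circle (R : realType) (eps : R) : Defs.arc eps `<=` @unit_circle R.
Proof. by move=> z [x _ <-]; apply/circleP; rewrite cos2Dsin2. Qed.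

Lemma measurable_arc (R : realType) (eps : R) : 0 < eps <= pi ->
  measurable (Defs.arc eps : set (borelC R)).
Proof.
move=> e; rewrite arcE //; apply: measurableI => //.
have -> : [set z : R[i] | complex.Re z <= cos eps] =
    setT `&` (@complex.Re R : borelC R -> R) @^-1` `]-oo, cos eps]%classic.
  by rewrite setTI; apply/seteqP; split=> z /=; rewrite in_itv.
exact: Re_measurable.
Qed.

(** * Bounded measurable functions on the circle *)

Section bounded_measurable.
Context (R : realType).
Local Notation T := (@unit_circle R : set (borelC R)).

(** A class closed under ring operations and conjugation whose members are integrable on every
    measurable part of the circle, as [mu] is finite. Membership replaces the integrability side
    conditions of linearity. *)
Definition bmeas (f : R[i] -> R[i]) :=
  [/\ measurable_fun T (fun z : borelC R => complex.Re (f z)),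
      measurable_fun T (fun z : borelC R => complex.Im (f z)) &
      exists M, forall z, T z -> `|complex.Re (f z)| <= M /\
                                 `|complex.Im (f z)| <= M].

Lemma eq_bmeas f g : (forall z, T z -> f z = g z) -> bmeas f -> bmeas g.
Proof.
move=> fg [fR fI [M fM]]; split.
- by apply: eq_measurable_fun fR => z; rewrite inE => /fg ->.
- by apply: eq_measurable_fun fI => z; rewrite inE => /fg ->.
- by exists M => z Tz; rewrite -fg //; exact: fM.
Qed.

Lemma bmeas_cst (c : R[i]) : bmeas (fun=> c).
Proof.
split; [exact: measurable_cst|exact: measurable_cst|].
exists (`|complex.Re c| + `|complex.Im c|) => z _.
by rewrite lerDl lerDr !normr_ge0.
Qed.

Lemma bmeas_id : bmeas id.
Proof.
split; [exact: Re_measurable|exact: Im_measurable|].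
by exists 1 => z Tz; rewrite circle_Re ?circle_Im.
Qed.

Lemma bmeasD f g : bmeas f -> bmeas g -> bmeas (fun z => f z + g z).
Proof.
move=> [fR fI [M fM]] [gR gI [N gN]]; split.
- by under eq_fun do rewrite ReD; exact: measurable_funD.
- by under eq_fun do rewrite ImD; exact: measurable_funD.
exists (M + N) => z Tz; have [? ?] := fM z Tz; have [? ?] := gN z Tz.
by rewrite ReD ImD; split; apply: le_trans (ler_normD _ _) _; rewrite lerD.
Qed.

Lemma bmeasM f g : bmeas f -> bmeas g -> bmeas (fun z => f z * g z).
Proof.
move=> [fR fI [M fM]] [gR gI [N gN]]; split.
- by under eq_fun do rewrite ReM; apply: measurable_funB; exact:
  measurable_funM.
- by under eq_fun do rewrite ImM; apply: measurable_funD; exact: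
  measurable_funM.
exists (M * N + M * N) => z Tz; have [? ?] := fM z Tz; have [? ?] := gN z Tz.
rewrite ReM ImM; split.
- by apply: le_trans (ler_normB _ _) _; rewrite !normrM lerD // ler_pM.
- by apply: le_trans (ler_normD _ _) _; rewrite !normrM lerD // ler_pM.
Qed.

Lemma bmeasJ f : bmeas f -> bmeas (fun z => (f z)^*).
Proof.
move=> [fR fI [M fM]]; split.
- by under eq_fun do rewrite ReJ.
- by under eq_fun do rewrite ImJ; exact: measurable_funN.
- by exists M => z Tz; rewrite ReJ ImJ normrN; exact: fM.
Qed.

Lemma bmeasN f : bmeas f -> bmeas (fun z => - f z).
Proof.
move=> bf; apply: eq_bmeas (bmeasM (bmeas_cst (-1)) bf) => z _.
by rewrite mulN1r.
Qed.

Lemma bmeasB f g : bmeas f -> bmeas g -> bmeas (fun z => f z - g z).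
Proof. by move=> bf /bmeasN bg; exact: bmeasD. Qed.

Lemma bmeas_horner (p : {poly R[i]}) : bmeas (horner p).
Proof.
elim/poly_ind: p => [|p c IH].
  by apply: eq_bmeas (bmeas_cst 0) => z _; rewrite horner0.
apply: eq_bmeas (bmeasD (bmeasM IH bmeas_id) (bmeas_cst c)) => z _.
by rewrite hornerMXaddC.
Qed.

(** On the circle z^-n is the conjugate of z^n, so the pole at 0 does not matter. *)
Lemma bmeas_exprV n : bmeas (fun z => z ^- n).
Proof.
apply: eq_bmeas (bmeasJ (bmeas_horner 'X^n)) => z Tz.
by rewrite hornerXn rmorphXn /= -circle_inv // exprVn.
Qed.

End bounded_measurable.

(** * Complex integrals *)

Section complex_integral.
Context (R : realType) (mu : probability (borelC R) R).
Local Notation T := (@unit_circle R : set (borelC R)).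
Implicit Types (D : set (borelC R)) (f g : R[i] -> R[i]).

Lemma eq_cintegral D f g : (forall z, D z -> f z = g z) ->
  cintegral mu D f = cintegral mu D g.
Proof.
by move=> fg; congr (_ +i* _); apply: eq_Rintegral => z; rewrite inE => /fg ->.
Qed.

Lemma eq_cintegrable D f g : measurable D -> (forall z, D z -> f z = g z) ->
  cintegrable mu D f -> cintegrable mu D g.
Proof.
move=> mD fg [fR fI]; split.
- by apply: eq_integrable fR => // z; rewrite inE => /fg ->.
- by apply: eq_integrable fI => // z; rewrite inE => /fg ->.
Qed.

Lemma cintegrableD D f g : measurable D ->
  cintegrable mu D f -> cintegrable mu D g ->
  cintegrable mu D (fun z => f z + g z).
Proof.
move=> mD [fR fI] [gR gI]; split.
- apply: eq_integrable (integrableD mD fR gR) => // z _ /=.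
  by rewrite ReD EFinD.
- apply: eq_integrable (integrableD mD fI gI) => // z _ /=.
  by rewrite ImD EFinD.
Qed.

Lemma cintegralD D f g : measurable D ->
  cintegrable mu D f -> cintegrable mu D g ->
  cintegral mu D (fun z => f z + g z) = cintegral mu D f + cintegral mu D g.
Proof.
move=> mD [fR fI] [gR gI]; apply: complex_ext; rewrite ?ReD ?ImD /=.
- by under eq_Rintegral do rewrite ReD; rewrite RintegralD.
- by under eq_Rintegral do rewrite ImD; rewrite RintegralD.
Qed.

Lemma cintegrableZ D (c : R[i]) f : measurable D ->
  cintegrable mu D f -> cintegrable mu D (fun z => c * f z).
Proof.
move=> mD [fR fI]; split.
- apply: eq_integrable (integrableB mD (integrableZl mD (complex.Re c) fR)
    (integrableZl mD (complex.Im c) fI)) => // z _ /=.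
  by rewrite ReM EFinB !EFinM.
- apply: eq_integrable (integrableD mD (integrableZl mD (complex.Re c) fI)
    (integrableZl mD (complex.Im c) fR)) => // z _ /=.
  by rewrite ImM EFinD !EFinM.
Qed.

Lemma cintegralZ D (c : R[i]) f : measurable D -> cintegrable mu D f ->
  cintegral mu D (fun z => c * f z) = c * cintegral mu D f.
Proof.
move=> mD [fR fI].
have iR (a : R) := integrableZl mD a fR.
have iI (a : R) := integrableZl mD a fI.
apply: complex_ext; rewrite ?ReM ?ImM /=.
- under eq_Rintegral do rewrite ReM.
  by rewrite RintegralB ?RintegralZl //; [exact: iR|exact: iI].
- under eq_Rintegral do rewrite ImM.
  by rewrite RintegralD ?RintegralZl //; [exact: iI|exact: iR].
Qed.

Lemma cintegral_conj D f : measurable D -> cintegrable mu D f ->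
  cintegral mu D (fun z => (f z)^*) = (cintegral mu D f)^*.
Proof.
move=> mD [fR fI]; apply: complex_ext; rewrite ?ReJ ?ImJ /=.
- by under eq_Rintegral do rewrite ReJ.
- under eq_Rintegral do rewrite ImJ -mulN1r.
  by rewrite RintegralZl // mulN1r.
Qed.

Lemma bmeas_cintegrable D f : measurable D -> D `<=` T -> bmeas f ->
  cintegrable mu D f.
Proof.
move=> mD DT [fR fI [M fM]].
have muD : (mu D < +oo)%E.
  by rewrite (le_lt_trans (probability_le1 mu mD)) // ltry.
split; apply: measurable_bounded_integrable => //.
- exact: measurable_funS (@measurable_circle R) DT fR.
- exists M; split; first exact: num_real.
  by move=> x Mx z Dz; apply: le_trans (ltW Mx); exact: (fM z (DT z Dz)).1.
- exact: measurable_funS (@measurable_circle R) DT fI.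
- exists M; split; first exact: num_real.
  by move=> x Mx z Dz; apply: le_trans (ltW Mx); exact: (fM z (DT z Dz)).2.
Qed.

Lemma bmeas_cintegrable_circle f : bmeas f -> cintegrable mu T f.
Proof. by apply: bmeas_cintegrable => //; exact: measurable_circle. Qed.

Local Notation E := (cintegral mu T).

Lemma circle_integralD f g : bmeas f -> bmeas g ->
  E (fun z => f z + g z) = E f + E g.
Proof.
by move=> bf bg; rewrite cintegralD //; try exact: measurable_circle;
  exact: bmeas_cintegrable_circle.
Qed.

Lemma circle_integralZ c f : bmeas f -> E (fun z => c * f z) = c * E f.
Proof.
by move=> bf; rewrite cintegralZ //; try exact: measurable_circle;
  exact: bmeas_cintegrable_circle.
Qed.

Lemma circle_integralN f : bmeas f -> E (fun z => - f z) = - E f.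
Proof.
move=> bf; rewrite -mulN1r -circle_integralZ //.
by apply: eq_cintegral => z _; rewrite mulN1r.
Qed.

Lemma circle_integralB f g : bmeas f -> bmeas g ->
  E (fun z => f z - g z) = E f - E g.
Proof.
move=> bf bg; rewrite -circle_integralN // circle_integralD //.
exact: bmeasN.
Qed.

Lemma circle_integral_conj f : bmeas f -> E (fun z => (f z)^*) = (E f)^*.
Proof.
by move=> bf; rewrite cintegral_conj //; try exact: measurable_circle;
  exact: bmeas_cintegrable_circle.
Qed.

Lemma circle_integral_cst c : mu T = 1%E -> E (fun=> c) = c.
Proof.
move=> mT; apply: complex_ext; rewrite /= Rintegral_cst;
  try exact: measurable_circle; by rewrite (congr1 fine mT) mulr1.
Qed.

Lemma circle_integral_sum n (f : nat -> R[i] -> R[i]) :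
  (forall k, bmeas (f k)) ->
  bmeas (fun z => \sum_(k < n) f k z) /\
  E (fun z => \sum_(k < n) f k z) = \sum_(k < n) E (f k).
Proof.
move=> bf; elim: n => [|n [bS IH]].
  split; first by apply: eq_bmeas (bmeas_cst 0) => z _; rewrite big_ord0.
  rewrite big_ord0 -[RHS](mul0r (E (fun=> 0))) -circle_integralZ.
    by apply: eq_cintegral => z _; rewrite big_ord0 mulr0.
  exact: bmeas_cst.
split; first by apply: eq_bmeas (bmeasD bS (bf n)) => z _; rewrite big_ord_recr.
rewrite big_ord_recr /= -IH -circle_integralD //.
by apply: eq_cintegral => z _; rewrite big_ord_recr.
Qed.

End complex_integral.

(** * Principal values of bounded functions *)

Section principal_value.
Context (R : realType) (mu : probability (borelC R) R).
Hypothesis mu_circle : mu (@unit_circle R) = 1%E.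
Local Notation T := (@unit_circle R : set (borelC R)).
Local Notation E := (cintegral mu T).
Implicit Types (D : set (borelC R)) (f g h : R[i] -> R[i]).

Lemma circle_integral_ge0 f :
  (forall z, T z -> 0 <= f z) -> 0 <= E f.
Proof.
move=> f0; rewrite lecE /=; apply/andP; split.
  apply/eqP; rewrite (eq_Rintegral mu (g := fun=> 0)).
    by rewrite Rintegral_cst ?mul0r //; exact: measurable_circle.
  by move=> z; rewrite inE => /f0; rewrite lecE => /andP[/eqP].
by apply: Rintegral_ge0 => z /f0; rewrite lecE => /andP[].
Qed.

Lemma circle_integral_norm2_eq0 f : bmeas f ->
  E (fun z => f z * (f z)^*) = 0 -> mu.-negligible (T `&` [set z | f z != 0]).
Proof.
move=> bf Ef0.
have mT := @measurable_circle R.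
have [iff _] := bmeas_cintegrable_circle mu (bmeasM bf (bmeasJ bf)).
have ff0 z : 0 <= complex.Re (f z * (f z)^*).
  by rewrite ReM ReJ ImJ mulrN opprK addr_ge0 -?expr2 ?sqr_ge0.
have i0 : (\int[mu]_(z in T) (complex.Re (f z * (f z)^*))%:E)%E = 0%E.
  rewrite -[LHS]fineK; last exact: integrable_fin_num.
  exact: (congr1 (fun w => (complex.Re w)%:E) Ef0).
have : (\int[mu]_(z in T) `|(complex.Re (f z * (f z)^*))%:E|)%E = 0%E.
  by rewrite -i0; apply: eq_integral => z _; rewrite gee0_abs ?lee_fin.
have mff : measurable_fun T
    (fun z : borelC R => (complex.Re (f z * (f z)^*))%:E).
  by move: iff => /integrableP[].
move=> /(ae_eq_integral_abs mu mT mff); apply: negligibleS.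
move=> z [Tz /= fz] /(_ Tz) [] /eqP.
rewrite ReM ReJ ImJ mulrN opprK -!expr2 paddr_eq0 ?sqr_ge0 // !sqrf_eq0.
by case/andP=> /eqP f1 /eqP f2; case/eqP: fz; exact: complex_ext.
Qed.

Hypothesis no_atom : mu [set (1 : R[i])] = 0%E.

(** The caps Re z > 1 - 1/(n+1) decrease to the point 1, which has no mass, so their measures tend
    to 0. The angle [acos (1 - n.+1%:R^-1)] is where the n-th cap begins. *)
Lemma measure_circle_arc_small (d : R) : 0 < d -> exists2 e : R,
  0 < e <= pi & forall x, 0 < x <= e -> (mu (T `\` Defs.arc x) <= d%:E)%E.
Proof.
move=> d0.
pose F n : set (borelC R) := T `&` [set z | 1 - n.+1%:R^-1 < complex.Re z].
have mF n : measurable (F n).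
  apply: measurableI; first exact: measurable_circle.
  have -> : [set z : R[i] | 1 - n.+1%:R^-1 < complex.Re z] = setT `&`
      (@complex.Re R : borelC R -> R) @^-1` `]1 - n.+1%:R^-1, +oo[%classic.
    by rewrite setTI; apply/seteqP; split=> z /=; rewrite in_itv /= andbT.
  exact: Re_measurable.
have capF : \bigcap_n F n = [set 1].
  apply/seteqP; split=> [z zF|_ -> n _]; last first.
    split; first by rewrite /unit_circle /= normr1.
    by rewrite /= ltrBlDr ltrDl invr_gt0.
  have [Tz _] := zF 0%N I; apply/eqP/negPn/negP => /(circle_Re_lt1 Tz).
  rewrite -subr_gt0 => z1.
  have [n _ zn] := near_infty_natSinv_lt (PosNum z1).
  have [_ /=] := zF n I; rewrite ltrBlDr -ltrBlDl => zn'.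
  by have := lt_trans zn' (zn n (leqnn n)); rewrite ltxx.
have : (mu \o F) n @[n --> \oo] --> 0%E.
  rewrite -no_atom -capF; apply: nonincreasing_cvg_mu => //.
  - by rewrite (le_lt_trans (probability_le1 mu (mF 0%N))) // ltry.
  - exact: bigcapT_measurable.
  - move=> m n mn; apply/subsetPset => z [Tz /= zn]; split=> //=.
    by apply: le_lt_trans zn; rewrite lerD2l lerN2 lef_pV2 ?posrE // ler_nat.
move=> /fine_cvg /cvgrPdist_le /(_ d d0) [n _ /(_ n (leqnn n))] /=.
rewrite sub0r normrN ger0_norm ?fine_ge0 // -lee_fin fineK; last first.
  exact: fin_num_measure.
have n0 : 0 < n.+1%:R^-1 :> R by rewrite invr_gt0.
have n1 : n.+1%:R^-1 <= 1 :> R by rewrite invf_le1 // ler1n.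
have /andP[c0 c1] : -1 <= (1 - n.+1%:R^-1 : R) < 1.
  by move: n.+1%:R^-1 n0 n1 => u u0 u1; apply/andP; split; lra.
move=> Fd; exists (acos (1 - n.+1%:R^-1)); first by rewrite acos_gt0 ?acos_lepi
  ?c0 ?(ltW c1).
move=> x /andP[x0 xe]; apply: le_trans Fd.
have xpi : x <= pi by rewrite (le_trans xe) ?acos_lepi ?c0 ?(ltW c1).
have ax : measurable (Defs.arc x : set (borelC R)).
  by apply: measurable_arc; rewrite x0.
apply: le_measure; rewrite ?inE //.
  by apply: measurableD => //; exact: measurable_circle.
move=> z [Tz]; rewrite arcE ?x0 // => /not_andP[//|/= /negP].
rewrite -ltNge => xz; split=> //=; apply: le_lt_trans xz.
rewrite -[leLHS]acosK ?in_itv /= ?c0 ?(ltW c1) // ler_cos //.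
  by rewrite in_itv /= (ltW x0).
by rewrite in_itv /= acos_ge0 ?acos_lepi ?c0 ?(ltW c1).
Qed.

Lemma cvg_arc_integral (f : borelC R -> R) (M : R) : measurable_fun T f ->
  (forall z, T z -> `|f z| <= M) ->
  (\int[mu]_(z in Defs.arc x) f z : R^o) @[x --> 0^'+] -->
  (\int[mu]_(z in T) f z : R^o).
Proof.
move=> mf fM; have mT := @measurable_circle R.
have muD D : measurable D -> (mu D < +oo)%E.
  by move=> mD; rewrite (le_lt_trans (probability_le1 mu mD)) // ltry.
have intf D : measurable D -> D `<=` T -> mu.-integrable D (EFin \o f).
  move=> mD DT; apply: measurable_bounded_integrable => //; first exact: muD.
    exact: measurable_funS mT DT mf.
  exists M; split; first exact: num_real.
  by move=> x Mx z Dz; apply: le_trans (ltW Mx); exact: (fM z (DT z Dz)).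
apply/cvgrPdist_le => e e0.
(* A strictly positive bound for [f], by which [e] can be divided. *)
have M1 : 0 < `|M| + 1 by rewrite ltr_wpDl.
have [x0 /andP[x00 x0pi] muarc] := measure_circle_arc_small (divr_gt0 e0 M1).
near=> x.
have xx : 0 < x <= pi.
  by apply/andP; split; [|apply: le_trans x0pi]; near: x;
    [exact: nbhs_right_gt|exact: nbhs_right_le].
have marc := measurable_arc xx.
have mTa : measurable (T `\` Defs.arc x) by exact: measurableD.
have TE : T = Defs.arc x `|` (T `\` Defs.arc x).
  by rewrite setDUK //; exact: arc_circle.
have -> : \int[mu]_(z in T) f z = \int[mu]_(z in Defs.arc x) f z +
    \int[mu]_(z in T `\` Defs.arc x) f z.
  rewrite {1}TE Rintegral_setU -?TE //; first exact: intf.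
  by apply/disj_setPS => z [? []].
rewrite addrAC subrr add0r.
apply: le_trans (le_normr_Rintegral mTa (intf _ mTa (@subDsetl _ _ _))) _.
apply: (@le_trans _ _ (\int[mu]_(z in T `\` Defs.arc x) (`|M| + 1))).
  apply: le_Rintegral => //.
  - by apply: integrable_norm; apply: intf => //; exact: subDsetl.
  - exact: finite_measure_integrable_cst.
  move=> z [Tz _]; rewrite (le_trans (fM z Tz)) // (le_trans (ler_norm _)) //.
  by rewrite lerDl.
rewrite Rintegral_cst // mulrC -ler_pdivlMr // -lee_fin fineK; last first.
  exact: fin_num_measure.
apply: muarc; case/andP: xx => -> _ /=.
by near: x; exact: nbhs_right_le.
Unshelve. all: by end_near. Qed.

Lemma cvg_pv_trunc f : bmeas f ->
  pv_trunc mu f x @[x --> 0^'+] --> (E f : R[i]^o).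
Proof.
move=> [fR fI [M fM]]; apply: cvg_complex => /=.
- by apply: (cvg_arc_integral fR) => z Tz; exact: (fM z Tz).1.
- by apply: (cvg_arc_integral fI) => z Tz; exact: (fM z Tz).2.
Qed.

End principal_value.

(** * The kernel z/(z-1) *)

Section cauchy_kernel.
Context (R : realType).
Implicit Types (z : R[i]).

(* [|z - 1| ^- 2] on the unit circle, with junk value [0] at [1]. *)
Definition sqdist1V z : R := (2 * (1 - complex.Re z))^-1.

Lemma sqdist1V_ge0 z : unit_circle z -> 0 <= sqdist1V z.
Proof.
move=> Tz; rewrite invr_ge0 mulr_ge0 ?subr_ge0 //.
exact: le_trans (ler_norm _) (circle_Re Tz).
Qed.

Lemma sqdist1V_norm z : unit_circle z -> z != 1 ->
  (sqdist1V z)%:C * ((z - 1) * (z - 1)^*) = 1.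
Proof.
move=> Tz z1; have /circleP zz := Tz; have z2 := circle_Re_lt1 Tz z1.
apply: complex_ext; rewrite !(ReM, ImM, ReJ, ImJ, ReD, ImD, ReN, ImN) /=.
  rewrite /sqdist1V.
  transitivity ((2 * (1 - complex.Re z))^-1 *
    (complex.Re z ^+ 2 + complex.Im z ^+ 2 + 1 - 2 * complex.Re z)); first ring.
  rewrite zz; field; lra.
ring.
Qed.

(** At z = 1 both sides are 0 by the convention on inverses, so the identity holds on the whole
    circle and J reduces to a real integral. *)
Lemma J_integrandE z : unit_circle z ->
  z * (z - 1)^-1 * (1 - z)^-1 = (sqdist1V z)%:C.
Proof.
move=> Tz; have [->|z1] := eqVneq z 1.
  by rewrite /sqdist1V /= !subrr !invr0 !mulr0 invr0.
have z1' : z - 1 != 0 by rewrite subr_eq0.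
have h := sqdist1V_norm Tz z1.
have -> : (z - 1)^-1 = (sqdist1V z)%:C * (z - 1)^*.
  by apply: (mulfI z1'); rewrite divff //; apply: etrans (esym h) _; ring.
have z1'' : 1 - z != 0 by rewrite subr_eq0 eq_sym.
apply: (canLR (mulfK z1'')); rewrite rmorphB rmorph1.
rewrite (_ : z * _ = (sqdist1V z)%:C * (z * z^* - z)); last ring.
by rewrite circle_mulJ.
Qed.

Lemma kernelE z : unit_circle z -> z != 1 ->
  z / (z - 1) = 2^-1 +i* (- (complex.Im z * sqdist1V z)).
Proof.
move=> Tz z1; have z1' : z - 1 != 0 by rewrite subr_eq0.
apply: (mulIf z1'); rewrite divfK //.
have /circleP zz := Tz; have z2 := circle_Re_lt1 Tz z1.
have z3 : 1 - complex.Re z != 0 by rewrite gt_eqF // subr_gt0.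
apply: complex_ext; rewrite !(ReM, ImM, ReD, ImD, ReN, ImN) /= /sqdist1V.
  rewrite subr0 mulNr opprK.
  have -> : complex.Im z / (2 * (1 - complex.Re z)) * complex.Im z =
    (1 - complex.Re z ^+ 2) / (2 * (1 - complex.Re z)) by rewrite -zz; ring.
  by field.
by field.
Qed.

Lemma kernel_norm z : unit_circle z -> z != 1 ->
  (z / (z - 1)) * (z / (z - 1))^* = (sqdist1V z)%:C.
Proof.
move=> Tz z1; have z1' : z - 1 != 0 by rewrite subr_eq0.
rewrite rmorphM /= fmorphV /=.
apply: (mulIf (x := (z - 1) * (z - 1)^*)).
  by rewrite mulf_neq0 // conjC_eq0.
rewrite (sqdist1V_norm Tz z1); apply: etrans (circle_mulJ Tz).
have : (z - 1)^* != 0 by rewrite conjC_eq0.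
by move: (z - 1) (z - 1)^* z1' => a b a0 b0; field; rewrite ?a0 ?b0.
Qed.

Lemma sqdist1V_measurable (D : set (borelC R)) : measurable D ->
  measurable_fun D (sqdist1V : borelC R -> R).
Proof.
move=> mD; apply: (@measurableT_comp _ _ _ _ _ _ (@GRing.inv R)).
  exact: invr_measurable.
apply: measurable_funM => //; apply: measurable_funB => //.
exact: Re_measurable.
Qed.

Lemma arc_neq1 (x : R) : 0 < x <= pi -> ~ Defs.arc x (1 : R[i]).
Proof.
move=> xpi; rewrite arcE // => -[_ /=]; apply/negP; rewrite -ltNge.
have /andP[x0 xp] := xpi.
by rewrite -cos0 ltr_cos // in_itv /= ?lexx ?pi_ge0 // (ltW x0).
Qed.

Lemma sqdist1V_arc_le (x : R) z : 0 < x <= pi -> Defs.arc x z ->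
  0 <= sqdist1V z <= (2 * (1 - cos x))^-1.
Proof.
move=> xpi; rewrite arcE // => -[Tz /= zx]; rewrite sqdist1V_ge0 //=.
have /andP[x0 xp] := xpi.
have c1 : cos x < 1.
  by rewrite -cos0 ltr_cos // in_itv /= ?lexx ?pi_ge0 // (ltW x0).
by rewrite lef_pV2 ?posrE; lra.
Qed.

Lemma kernel_arc_cintegrable (mu : probability (borelC R) R) (x : R) :
  0 < x <= pi -> cintegrable mu (Defs.arc x) (fun z => z / (z - 1)).
Proof.
move=> xpi; have mA := measurable_arc xpi.
have an1 z : Defs.arc x z -> z != 1.
  by move=> Az; apply: contra_not_neq (arc_neq1 xpi) => <-.
have aT z : Defs.arc x z -> unit_circle z by apply: arc_circle.
apply: (eq_cintegrable mA
  (f := fun z => 2^-1 +i* (- (complex.Im z * sqdist1V z)))).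
  by move=> z Az; rewrite kernelE ?an1 //; exact: aT.
split=> /=; first exact: finite_measure_integrable_cst.
apply: measurable_bounded_integrable => //.
- by rewrite (le_lt_trans (probability_le1 mu mA)) // ltry.
- apply: measurable_funN; apply: measurable_funM; first exact: Im_measurable.
  exact: sqdist1V_measurable.
exists ((2 * (1 - cos x))^-1); split; first exact: num_real.
move=> M /ltW xM z Az; rewrite /= normrN normrM; apply: le_trans xM.
have /andP[g0 gx] := sqdist1V_arc_le xpi Az.
rewrite -[leRHS]mul1r ler_pM //; first exact/circle_Im/aT.
by rewrite ger0_norm.
Qed.

End cauchy_kernel.

Section kernel_integrals.
Context (R : realType) (mu : probability (borelC R) R).
Hypothesis mu_circle : mu (@unit_circle R) = 1%E.
Hypothesis no_atom : mu [set (1 : R[i])] = 0%E.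
Local Notation T := (@unit_circle R : set (borelC R)).
Local Notation E := (cintegral mu T).
Implicit Types (f h l : R[i] -> R[i]).

Lemma near_arc_bounds : \forall x \near (0 : R)^'+, 0 < x <= pi.
Proof.
near=> x; apply/andP; split; near: x; first exact: nbhs_right_gt.
by apply: nbhs_right_le; exact: pi_gt0.
Unshelve. all: by end_near. Qed.

Lemma pv_integralE f (L : R[i]) :
  pv_trunc mu f x @[x --> 0^'+] --> (L : R[i]^o) -> pv_integral mu f = L.
Proof. by move=> fL; apply: (cvg_lim _ fL); exact: norm_hausdorff. Qed.

Section regular.
Variables (l h : R[i] -> R[i]) (a : R[i]).
Hypothesis bh : bmeas h.
Hypothesis lE : forall z, T z -> z != 1 -> l z = a + (z - 1) * h z.

Let bzh : bmeas (fun z => z * h z).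
Proof. by apply: bmeasM => //; exact: bmeas_id. Qed.

Let arc_kernelE (x : R) z : 0 < x <= pi -> Defs.arc x z ->
  a * (z / (z - 1)) + z * h z = l z * (z / (z - 1)).
Proof.
move=> xpi Az.
have z1 : z != 1 by apply: contra_not_neq (arc_neq1 xpi) => <-.
rewrite lE //; last exact: arc_circle Az.
by field; rewrite subr_eq0.
Qed.

Lemma regular_arc_cintegrable (x : R) : 0 < x <= pi ->
  cintegrable mu (Defs.arc x) (fun z => l z * (z / (z - 1))).
Proof.
move=> xpi; have mA := measurable_arc xpi.
apply: eq_cintegrable (fun z => @arc_kernelE x z xpi) _ => //.
apply: cintegrableD => //.
- by apply: cintegrableZ => //; exact: kernel_arc_cintegrable.
- by apply: bmeas_cintegrable => //; exact: arc_circle.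
Qed.

(** Off 1 the product of l with the kernel k is a k + z h, and z h is bounded: only the term a k has
    a genuine principal value. *)
Lemma cvg_pv_regular (c : R[i]) :
  pv_trunc mu (fun z => z / (z - 1)) x @[x --> 0^'+] --> (c : R[i]^o) ->
  pv_trunc mu (fun z => l z * (z / (z - 1))) x @[x --> 0^'+] -->
  (a * c + E (fun z => z * h z) : R[i]^o).
Proof.
move=> ck.
have lim : a * pv_trunc mu (fun z => z / (z - 1)) x +
    pv_trunc mu (fun z => z * h z) x @[x --> 0^'+] -->
    (a * c + E (fun z => z * h z) : R[i]^o).
  apply: (@cvgD R[i] R[i]^o _ _ _ (fun x => a * pv_trunc mu _ x)).
    apply: (@cvgM R[i] _ _ _ (fun=> a) (pv_trunc mu _)) ck.
    exact: (@cvg_cst R[i]^o).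
  exact: cvg_pv_trunc.
apply: cvg_trans lim; apply: near_eq_cvg.
near=> x.
have xpi : 0 < x <= pi by near: x; exact: near_arc_bounds.
have mA := measurable_arc xpi.
have kA := kernel_arc_cintegrable mu xpi.
rewrite /pv_trunc -cintegralZ // -cintegralD //; last 2 first.
- exact: cintegrableZ.
- by apply: bmeas_cintegrable => //; exact: arc_circle.
by apply: eq_cintegral => z; exact: arc_kernelE.
Unshelve. all: by end_near. Qed.

(* Young's inequality [2 Re (b l k) <= |l|^2 + |k|^2] for the kernel [k], which
   needs [k] to be square integrable. *)
Lemma pv_kernel_young (b c : R[i]) : `|b| = 1 -> bmeas l ->
  pv_trunc mu (fun z => l z * (z / (z - 1))) x @[x --> 0^'+] --> (c : R[i]^o) ->
  mu.-integrable T (fun z : borelC R => (sqdist1V z)%:E) ->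
  complex.Re (b * c) <=
  (complex.Re (E (fun z => l z * (l z)^*)) + \int[mu]_(z in T) sqdist1V z) / 2.
Proof.
move=> b1 bl lc iJ.
have mT := @measurable_circle R.
have bll := bmeasM bl (bmeasJ bl).
have [ill _] := bmeas_cintegrable_circle mu bll.
have lim : (complex.Re (b * pv_trunc mu (fun z => l z * (z / (z - 1))) x) : R^o)
    @[x --> 0^'+] --> (complex.Re (b * c) : R^o).
  apply: (@cvg_Re _ _ _ _ (fun x => b * pv_trunc mu _ x)).
  apply: (@cvgM R[i] _ _ _ (fun=> b) (pv_trunc mu _)) lc.
  exact: (@cvg_cst R[i]^o).
apply: (cvgr_to_le lim); near=> x.
have xpi : 0 < x <= pi by near: x; exact: near_arc_bounds.
have mA := measurable_arc xpi.
have lA := regular_arc_cintegrable xpi.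
have [blR _] := cintegrableZ b mA lA.
rewrite /pv_trunc -cintegralZ //=.
pose g (z : borelC R) := complex.Re (l z * (l z)^*) + sqdist1V z.
have g0 z : T z -> 0 <= g z.
  move=> Tz; rewrite addr_ge0 ?sqdist1V_ge0 //.
  by rewrite ReM ReJ ImJ mulrN opprK -!expr2 addr_ge0 ?sqr_ge0.
have ig : mu.-integrable T (EFin \o g).
  by apply: eq_integrable (integrableD mT ill iJ).
have igA : mu.-integrable (Defs.arc x) (EFin \o g).
  by apply: integrableS ig => //; exact: arc_circle.
rewrite -RintegralD // mulrC -RintegralZl //.
apply: (@le_trans _ _ (\int[mu]_(z in Defs.arc x) (2^-1 * g z))).
  apply: le_Rintegral => //.
    by apply: eq_integrable (integrableZl mA 2^-1 igA).
  move=> z Az; have Tz := arc_circle Az.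
  have z1 : z != 1 by apply: contra_not_neq (arc_neq1 xpi) => <-.
  rewrite /g -[sqdist1V z]/(complex.Re (sqdist1V z)%:C) -kernel_norm //.
  have : b * b^* = 1 by rewrite -normCK b1 expr1n.
  move=> /(congr1 (@complex.Re R)).
  move: (z / (z - 1)) (l z) => v w.
  rewrite !(ReM, ImM, ReJ, ImJ) /=.
  (* The two squares add up to the squared modulus of v - conj(b w). *)
  have := sqr_ge0 (complex.Re v - complex.Re (b * w)).
  have := sqr_ge0 (complex.Im v + complex.Im (b * w)).
  rewrite !(ReM, ImM) /=; nra.
rewrite !RintegralZl // ler_pM2l ?invr_gt0 // /Rintegral fine_le //.
- exact: integrable_fin_num.
- exact: integrable_fin_num.
apply: ge0_subset_integral => //; last exact: arc_circle.
by move: ig => /integrableP[].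
Unshelve. all: by end_near. Qed.

End regular.

(** By [kernelE] the kernel has real part 1/2 off 1, so its truncations have the real parts of those
    of the constant 1/2, and the total mass is 1. *)
Lemma Re_pv_kernel (c : R[i]) :
  pv_trunc mu (fun z => z / (z - 1)) x @[x --> 0^'+] --> (c : R[i]^o) ->
  complex.Re c = 2^-1.
Proof.
move=> /cvg_Re ck.
have /cvg_Re := cvg_pv_trunc no_atom (bmeas_cst (2^-1 +i* 0 : R[i])).
rewrite circle_integral_cst //= => ch.
apply: (@cvg_unique _ (@Rhausdorff R) _ _ _ _ ck).
apply: cvg_trans ch; apply: near_eq_cvg; near=> x.
have xpi : 0 < x <= pi by near: x; exact: near_arc_bounds.
apply: eq_Rintegral => z; rewrite inE => Az.
rewrite kernelE //; first exact: arc_circle Az.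
by apply: contra_not_neq (arc_neq1 xpi) => <-.
Unshelve. all: by end_near. Qed.

End kernel_integrals.

(** * Geometric sums and the integrability of |z - 1|^-2 *)

Section dirichlet_sums.
Context (R : realType).
Implicit Types (z : R[i]).

Definition geom n z : R[i] := \sum_(k < n) z ^+ k.

Lemma bmeas_geom n : bmeas (@geom n).
Proof.
elim: n => [|n IH].
  by apply: eq_bmeas (bmeas_cst 0) => z _; rewrite /geom big_ord0.
apply: eq_bmeas (bmeasD IH (bmeas_horner 'X^n)) => z _.
by rewrite hornerXn /geom big_ord_recr.
Qed.

Lemma geomE n z : (z - 1) * geom n z = z ^+ n - 1.
Proof. by rewrite /geom subrX1. Qed.

Lemma geom_norm_sqr n z : unit_circle z -> z != 1 ->
  geom n z * (geom n z)^* =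
  (sqdist1V z * (2 - 2 * complex.Re (z ^+ n)))%:C.
Proof.
move=> Tz z1; rewrite -[LHS]mul1r -(sqdist1V_norm Tz z1) [RHS]rmorphM /=.
rewrite -mulrA; congr (_ * _).
rewrite mulrACA -rmorphM /= geomE rmorphB rmorph1.
have zn : z ^+ n * (z ^+ n)^* = 1.
  by rewrite rmorphXn /= -exprMn circle_mulJ ?expr1n.
rewrite rmorphB rmorphM /= ReJ_add !mulrBl !mulrBr zn.
by rewrite [(_ ^*)%C]/(_^*)%R; field.
Qed.

(** Since Re z^n >= -1, [geom_norm_sqr] gives |geom n z|^2 <= 4 [sqdist1V z]; then 2 x <= x^2 + 1.
    What matters is that the bound is free of n. *)
Lemma Re_geom_le n z : unit_circle z -> z != 1 ->
  complex.Re (geom n z) <= 4 * sqdist1V z + 1.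
Proof.
move=> Tz z1; have := geom_norm_sqr n Tz z1.
move=> /(congr1 (@complex.Re R)); rewrite ReM ReJ ImJ mulrN opprK /=.
have Tn : unit_circle (z ^+ n).
  by rewrite /unit_circle /= normrX (_ : `|z| = 1) ?expr1n.
have := circle_Re Tn; rewrite ler_norml => /andP[zn _].
have q0 := sqdist1V_ge0 Tz.
have := ler_wpM2l q0 zn; rewrite mulrN1.
have := sqr_ge0 (complex.Re (geom n z) - 1); have := sqr_ge0 (complex.Im (geom
  n z)).
move: (geom n z) (z ^+ n) => g w; lra.
Qed.

(** When [geom_norm_sqr] is summed, the powers of z form a geometric sum again; by [Re_geom_le] the
    correction is O(1/n). *)
Lemma geom_average n z : unit_circle z -> z != 1 ->
  n.+1%:R^-1 * \sum_(k < n.+1) complex.Re (geom k z * (geom k z)^*) =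
  2 * sqdist1V z - 2 * sqdist1V z * complex.Re (geom n.+1 z) / n.+1%:R.
Proof.
move=> Tz z1.
have -> : \sum_(k < n.+1) complex.Re (geom k z * (geom k z)^*) =
    n.+1%:R * (2 * sqdist1V z) - 2 * sqdist1V z * complex.Re (geom n.+1 z).
  elim: n.+1 => [|m IH].
    by rewrite /geom !big_ord0 /= mul0r mulr0 subrr.
  rewrite big_ord_recr /= IH geom_norm_sqr // [geom m.+1 z]big_ord_recr /= ReD.
  by rewrite -(natr1 m) -/(geom m z) /=; ring.
by rewrite mulrBr mulKf ?pnatr_eq0 // [_^-1 * _]mulrC.
Qed.

End dirichlet_sums.

(* Since [|geom n z|^2 |z - 1|^2 = 2 - 2 Re (z ^+ n)], the averages in [n] of
   [|geom n z|^2] tend to [2 |z - 1| ^- 2] off [1], and Fatou's lemma applies. *)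
Lemma sqdist1V_integrable (R : realType) (mu : probability (borelC R) R)
    (C : R) :
  (forall n, complex.Re (cintegral mu (@unit_circle R)
     (fun z => geom n z * (geom n z)^*)) <= C) ->
  mu.-integrable (@unit_circle R) (fun z : borelC R => (sqdist1V z)%:E).
Proof.
move=> bC; have mT := @measurable_circle R.
pose g n (z : borelC R) := complex.Re (geom n z * (geom n z)^*).
have g0 n z : 0 <= g n z.
  by rewrite /g ReM ReJ ImJ mulrN opprK -!expr2 addr_ge0 ?sqr_ge0.
have ig n : mu.-integrable (@unit_circle R) (EFin \o g n).
  by case: (bmeas_cintegrable_circle mu
    (bmeasM (bmeas_geom R n) (bmeasJ (bmeas_geom R n)))).
pose f n (z : borelC R) := n.+1%:R^-1 * \sum_(k < n.+1) g k z.
have f0 n z : 0 <= f n z by rewrite mulr_ge0 ?invr_ge0 // sumr_ge0.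
have fC n : mu.-integrable (@unit_circle R) (EFin \o f n) /\
    (\int[mu]_(z in @unit_circle R) (f n z)%:E <= C%:E)%E.
  have gsum : mu.-integrable (@unit_circle R)
      (fun z : borelC R => (\sum_(k < n.+1) (g k z)%:E)%E).
    by apply: integrable_sum => // k _; exact: ig.
  have fE z : (f n z)%:E = (n.+1%:R^-1%:E * (\sum_(k < n.+1) (g k z)%:E))%E.
    by rewrite sumEFin -EFinM.
  split.
    apply: eq_integrable (integrableZl mT n.+1%:R^-1 gsum) => // z _.
    by rewrite /= fE.
  under eq_integral do rewrite fE.
  rewrite integralZl // integral_sum //; last by move=> k; exact: ig.
  have gC (k : 'I_n.+1) : (\int[mu]_(z in @unit_circle R) (g k z)%:E <= C%:E)%E.
    rewrite -[leLHS]fineK; last by apply: integrable_fin_num => //; exact: ig.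
    by rewrite lee_fin; exact: bC.
  rewrite lee_pdivrMl //.
  apply: le_trans (lee_sum _ (fun k _ => gC k)) _.
  by rewrite sumEFin sumr_const card_ord -EFinM mulr_natl.
have mq : measurable_fun (@unit_circle R : set (borelC R))
    (fun z : borelC R => (sqdist1V z)%:E).
  by apply/measurable_EFinP; exact: sqdist1V_measurable.
apply/integrableP; split=> //.
have cvg_einfs (u : (\bar R)^nat) : cvgn (einfs u).
  exact: is_cvg_einfs.
have einf_le (u : (\bar R)^nat) (c : \bar R) :
    (forall n, (u n <= c)%E) -> (limn_einf u <= c)%E.
  move=> uc; rewrite limn_einf_lim; apply: lime_le => //.
  by apply: nearW => n; apply: le_trans (uc n); apply: ereal_inf_lbound; exists
    n => /=.
have einf_ge (u : (\bar R)^nat) (c : \bar R) :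
    (\forall n \near \oo, (c <= u n)%E) -> (c <= limn_einf u)%E.
  move=> [N _ uc]; rewrite limn_einf_lim; apply: lime_ge => //.
  exists N => // n /= Nn; apply: le_ereal_inf_tmp => _ [m /= nm <-].
  by apply: uc; rewrite /= (leq_trans Nn).
apply: (@le_lt_trans _ _ C%:E); last exact: ltry.
apply: (@le_trans _ _ (\int[mu]_(z in @unit_circle R)
    limn_einf (fun n => (f n z)%:E))%E); last first.
  apply: (le_trans (fatou mu mT _ _)).
  - by move=> n; case: (fC n) => /integrableP[].
  - by move=> n z _; rewrite lee_fin.
  - by apply: einf_le => n; case: (fC n).
apply: ge0_le_integral => //.
- exact: measurableT_comp.
- apply: (@measurableT_comp _ _ _ _ _ _ (@oppe R)) => //.
  apply: (measurable_fun_limn_esup (f := fun n z => (- (f n z)%:E)%E)) => n.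
  apply: (@measurableT_comp _ _ _ _ _ _ (@oppe R)) => //.
  by case: (fC n) => /integrableP[].
move=> z Tz; rewrite gee0_abs ?lee_fin ?sqdist1V_ge0 //; apply: einf_ge.
have [->|z1] := eqVneq z 1.
  by apply: nearW => n; rewrite lee_fin /sqdist1V /= subrr mulr0 invr0.
have K0 : 0 <= 2 * (4 * sqdist1V z + 1).
  by rewrite mulr_ge0 // addr_ge0 // mulr_ge0 // sqdist1V_ge0.
(* From this index on n + 1 >= 2 Re (geom (n+1) z), hence [f n z >= sqdist1V z]. This is half of the
   true limit, and enough for finiteness. *)
exists (Num.truncn (2 * (4 * sqdist1V z + 1))) => // n /= Kn.
have nK : 2 * (4 * sqdist1V z + 1) <= n.+1%:R.
  by rewrite ltW // (lt_le_trans (truncnS_gt _)) // ler_nat.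
rewrite lee_fin /f geom_average // -subr_ge0.
have n0 : n.+1%:R != 0 :> R by rewrite pnatr_eq0.
rewrite (_ : _ - _ = sqdist1V z *
  ((n.+1%:R - 2 * complex.Re (geom n.+1 z)) / n.+1%:R)); last by field.
rewrite mulr_ge0 ?sqdist1V_ge0 // divr_ge0 // subr_ge0.
by apply: le_trans nK; rewrite ler_pM2l // Re_geom_le.
Qed.

(** * Reversed polynomials and the inner product *)

Section revpoly_theory.
Context (R : realType).
Implicit Types (p q : {poly R[i]}).

Lemma coef_revpoly n p i :
  (revpoly n p)`_i = if (i <= n)%N then (p`_(n - i))^* else 0.
Proof. by rewrite /revpoly coef_poly ltnS. Qed.

Lemma size_revpoly n p : (size (revpoly n p) <= n.+1)%N.
Proof. exact: size_poly. Qed.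

Lemma revpolyB n p q : revpoly n (p - q) = revpoly n p - revpoly n q.
Proof.
apply/polyP => i; rewrite coefB !coef_revpoly coefB rmorphB.
by case: ifP => // _; rewrite subr0.
Qed.

Lemma revpolyZ n (c : R[i]) p : revpoly n (c *: p) = c^* *: revpoly n p.
Proof.
apply/polyP => i; rewrite coefZ !coef_revpoly coefZ rmorphM.
by case: ifP => // _; rewrite mulr0.
Qed.

Lemma revpolyXM n p : (size p <= n.+1)%N ->
  revpoly n.+1 ('X * p) = revpoly n p.
Proof.
move=> sp; apply/polyP => i; rewrite !coef_revpoly coefXM subn_eq0.
case: (leqP i n) => [lein|ltni]; first by rewrite leqW // subSn.
by case: (leqP i n.+1) => // _; rewrite conjC0.
Qed.

Lemma revpolyS_revpoly n p : (size p <= n.+1)%N ->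
  revpoly n.+1 (revpoly n p) = 'X * p.
Proof.
move=> sp; apply/polyP => i; rewrite coef_revpoly coefXM coef_revpoly.
case: i => [|i]; first by rewrite subn0 ltnn conjC0.
rewrite subSS leq_subr /= ltnS; case: (leqP i n) => [lein|ltni].
  by rewrite subKn // conjCK.
by rewrite nth_default // (leq_trans sp).
Qed.

Lemma horner_revpoly_circle n p z : (size p <= n.+1)%N -> unit_circle z ->
  (revpoly n p).[z] = z ^+ n * (p.[z])^*.
Proof.
move=> sp Tz; rewrite horner_revpoly ?circle_neq0 //.
by rewrite div1r -(circle_inv Tz) invrK.
Qed.

End revpoly_theory.

Section inner_product.
Context (R : realType) (mu : probability (borelC R) R).
Hypothesis mu_circle : mu (@unit_circle R) = 1%E.
Local Notation T := (@unit_circle R : set (borelC R)).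
Local Notation E := (cintegral mu T).
Implicit Types (p q r : {poly R[i]}).

Definition ip p q : R[i] := E (fun z => (p.[z])^* * q.[z]).

Let bmeas_ip p q : bmeas (fun z => (p.[z])^* * q.[z]).
Proof. by apply: bmeasM; [apply: bmeasJ|]; exact: bmeas_horner. Qed.

Lemma ipBr p q r : ip p (q - r) = ip p q - ip p r.
Proof.
rewrite -circle_integralB //; apply: eq_cintegral => z _.
by rewrite hornerD hornerN mulrBr.
Qed.

Lemma ipDr p q r : ip p (q + r) = ip p q + ip p r.
Proof.
rewrite -circle_integralD //; apply: eq_cintegral => z _.
by rewrite hornerD mulrDr.
Qed.

Lemma ipZr p (c : R[i]) q : ip p (c *: q) = c * ip p q.
Proof.
rewrite -circle_integralZ //; apply: eq_cintegral => z _.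
by rewrite hornerZ mulrCA.
Qed.

Lemma ipC p q : ip p q = (ip q p)^*.
Proof.
rewrite -circle_integral_conj //; apply: eq_cintegral => z _.
by rewrite rmorphM /= conjCK mulrC.
Qed.

Lemma ipDl p q r : ip (p + q) r = ip p r + ip q r.
Proof. by rewrite ipC ipDr rmorphD /= -!ipC. Qed.

Lemma ipZl (c : R[i]) p q : ip (c *: p) q = c^* * ip p q.
Proof. by rewrite ipC ipZr rmorphM /= -ipC. Qed.

Lemma ip0r p : ip p 0 = 0.
Proof. by rewrite -(scale0r 0) ipZr mul0r. Qed.

Lemma ip0l p : ip 0 p = 0.
Proof. by rewrite ipC ip0r conjC0. Qed.

Lemma ipXX p q : ip ('X * p) ('X * q) = ip p q.
Proof.
apply: eq_cintegral => z Tz; rewrite !hornerM hornerX rmorphM /=.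
by rewrite mulrACA [z^* * z]mulrC circle_mulJ // mul1r.
Qed.

(** On the circle reversal is p -> z^n conj(p), an antiunitary map, so the arguments swap. *)
Lemma ip_revpoly n p q : (size p <= n.+1)%N -> (size q <= n.+1)%N ->
  ip (revpoly n p) (revpoly n q) = ip q p.
Proof.
move=> sp sq; apply: eq_cintegral => z Tz.
rewrite !horner_revpoly_circle // rmorphM /= conjCK mulrACA rmorphXn /= -exprMn.
by rewrite [z^* * z]mulrC circle_mulJ // expr1n mul1r mulrC.
Qed.

Lemma ip_ge0 p : 0 <= ip p p.
Proof.
apply: circle_integral_ge0 => z _; rewrite mulrC -normCK.
by rewrite exprn_ge0.
Qed.

(** If the norm vanished, p would vanish almost everywhere on the circle; the complement of its
    zeros would be an open null set, and the support would lie in the finite set of zeros. *)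
Lemma ip_gt0 p : nontrivial mu -> p != 0 -> 0 < ip p p.
Proof.
move=> nt p0; rewrite lt_neqAle ip_ge0 andbT eq_sym.
apply: contra_notN nt => /eqP pp0.
have : mu.-negligible (T `&` [set z | p.[z] != 0]).
  apply: circle_integral_norm2_eq0; first exact: bmeas_horner.
  by rewrite -[RHS]pp0; apply: eq_cintegral => z _; rewrite mulrC.
move=> [N [mN N0 pN]].
have [rs rsP] : exists rs : seq R[i], forall z, root p z -> z \in rs.
  have [rs prs] := closed_field_poly_normal p; exists rs => z.
  by rewrite prs rootZ ?lead_coef_eq0 // root_prod_XsubC.
apply: (@sub_finite_set _ _ [set` rs]); last exact: finite_seq.
move=> z zS /=; apply: rsP; apply: contrapT => /negP zp.
have oU : open [set z : R[i]^o | p.[z] != 0].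
  apply: (@open_comp _ _ (fun z : R[i]^o => p.[z] : R[i]^o)
    [set y | y != 0]); first by move=> x _; exact: horner_continuous_complex.
  rewrite (_ : [set y | y != 0] = ~` [set (0 : R[i]^o)]).
    exact/closed_openC/accessible_closed_set1/hausdorff_accessible/norm_hausdorff.
  by apply/seteqP; split=> y /= /eqP.
have mU : measurable ([set z : R[i] | p.[z] != 0] : set (borelC R)).
  exact: sub_sigma_algebra.
have := zS _ oU zp; rewrite ltNge => /negP; apply.
have nT : mu.-negligible (~` T).
  apply/negligibleP; first by apply: measurableC; exact: measurable_circle.
  apply: (etrans (probability_setC mu (@measurable_circle R))).
  by apply: (etrans (congr1 (fun x => 1 - x)%E mu_circle)); rewrite subee.
suff : mu.-negligible [set z : R[i] | p.[z] != 0].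
  by move=> /(measure_negligible mU) ->.
apply: negligibleS (negligibleU (ex_intro _ N (And3 mN N0 pN)) nT) => y /= yp.
by have [Ty|Ty] := pselect (T y); [left|right].
Qed.

End inner_product.

(** * The Szego recursion *)

Section opuc.
Context (R : realType) (mu : probability (borelC R) R).
Hypothesis mu_circle : mu (@unit_circle R) = 1%E.
Hypothesis mu_nontrivial : nontrivial mu.
Variable S : nat -> {poly R[i]}.
Hypothesis S_opuc : monic_opuc mu S.
Local Notation ip := (ip mu).
Implicit Types (p q : {poly R[i]}) (n : nat).

Lemma opuc_size n : size (S n) = n.+1.
Proof. by case: S_opuc => /(_ n)[]. Qed.

Lemma opuc_monic n : S n \is monic.
Proof. by case: S_opuc => /(_ n)[]. Qed.

Lemma opuc_neq0 n : S n != 0.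
Proof. by rewrite -size_poly_eq0 opuc_size. Qed.

Lemma opuc0 : S 0 = 1.
Proof.
have /size_poly1P[c c0 S0] : size (S 0) == 1%N by rewrite opuc_size.
by have := opuc_monic 0; rewrite S0 monicE lead_coefC => /eqP ->.
Qed.

Lemma opuc_orth m n : m <> n -> ip (S m) (S n) = 0.
Proof. by case: S_opuc => _; exact. Qed.

Lemma opuc_expansion n p : (size p <= n)%N ->
  exists c : nat -> R[i], p = \sum_(k < n) c k *: S k.
Proof.
elim: n p => [|n IH] p sp.
  exists (fun=> 0); rewrite big_ord0; apply/eqP.
  by rewrite -size_poly_eq0 -leqn0.
have [|c cE] := IH (p - p`_n *: S n).
  apply/leq_sizeP => j; rewrite leq_eqVlt => /predU1P[<-|nj].
    have := opuc_monic n; rewrite monicE lead_coefE opuc_size /= => /eqP Sn.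
    by rewrite coefB coefZ Sn mulr1 subrr.
  rewrite coefB coefZ [(S n)`__]nth_default ?opuc_size // mulr0 subr0.
  by rewrite nth_default // (leq_trans sp nj).
exists (fun k => if k == n then p`_n else c k).
rewrite big_ord_recr /= eqxx; apply/eqP; rewrite -subr_eq cE; apply/eqP.
by apply: eq_bigr => k _; rewrite ltn_eqF.
Qed.

Lemma ip_sumr p n (c : nat -> R[i]) :
  ip p (\sum_(k < n) c k *: S k) = \sum_(k < n) c k * ip p (S k).
Proof.
elim: n => [|n IH]; first by rewrite !big_ord0 ip0r.
by rewrite !big_ord_recr /= ipDr ipZr IH.
Qed.

Lemma opuc_orth_lower n p : (size p <= n)%N -> ip p (S n) = 0.
Proof.
move=> /opuc_expansion[c ->]; rewrite ipC ip_sumr big1 ?conjC0 // => k _.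
by rewrite opuc_orth ?mulr0 //; apply/eqP; rewrite gtn_eqF.
Qed.

Lemma opuc_orth_lower_l n p : (size p <= n)%N -> ip (S n) p = 0.
Proof. by move=> sp; rewrite ipC opuc_orth_lower ?conjC0. Qed.

(** Reversal carries the orthogonality of [S n] to 1, ..., z^(n-1) over to z, ..., z^n. *)
Lemma revpoly_orth n q : (size q <= n)%N -> ip ('X * q) (revpoly n (S n)) = 0.
Proof.
case: n => [|n] sq.
  move: sq; rewrite leqn0 size_poly_eq0 => /eqP ->.
  by rewrite mulr0 ip0l.
rewrite -(revpolyS_revpoly sq) ip_revpoly ?opuc_size //; last first.
  by rewrite (leq_trans (size_revpoly _ _)).
by rewrite opuc_orth_lower_l // size_revpoly.
Qed.

(** The difference [D] of the two sides has degree at most n, and vanishes at 0 by the choice of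
    [verb], so [D = 'X * G] with G of degree below n. Then [D] is orthogonal to each of the three
    terms it is made of, hence to itself. *)
Lemma szego n : S n.+1 = 'X * S n - (verb S n.+1)^* *: revpoly n (S n).
Proof.
pose D := S n.+1 - ('X * S n - (verb S n.+1)^* *: revpoly n (S n)).
have monic_n k : (S k)`_k = 1.
  by have := opuc_monic k; rewrite monicE lead_coefE opuc_size /= => /eqP.
have sD : (size D <= n.+1)%N.
  apply/leq_sizeP => j; rewrite leq_eqVlt => /predU1P[<-|nj]; rewrite !coefB.
    rewrite monic_n coefXM /= monic_n coefZ [(revpoly _ _)`__]nth_default.
      by rewrite mulr0 subr0 subrr.
    exact: size_revpoly.
  rewrite !nth_default ?subrr ?opuc_size //.
    by rewrite (leq_trans (size_scale_leq _ _)) // (leq_trans (size_revpoly _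
      _)) // ltnW.
  by rewrite (leq_trans (size_polyMleq _ _)) // size_polyX opuc_size.
have D0 : D`_0 = 0.
  rewrite !coefB coefXM /= coefZ coef_revpoly /= subn0 monic_n conjC1 mulr1.
  by rewrite /verb rmorphN /= conjCK horner_coef0 sub0r opprK subrr.
have [G DG] : exists G, D = 'X * G.
  have /factor_theorem[G DG] : root D 0 by rewrite /root horner_coef0 D0.
  by exists G; rewrite DG polyC0 subr0 mulrC.
have sG : (size G <= n)%N.
  have [->|G0] := eqVneq G 0; first by rewrite size_poly0.
  by move: sD; rewrite DG mulrC size_mulX.
apply/eqP; rewrite -subr_eq0 -/D; apply/negPn/negP => /(ip_gt0 mu_circle
  mu_nontrivial).
rewrite {1}DG /D ipBr ipBr ipZr ipXX revpoly_orth // !opuc_orth_lower ?mulr0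
  ?subrr ?ltxx //.
by rewrite -DG.
Qed.

Lemma szego_rev n :
  revpoly n.+1 (S n.+1) = revpoly n (S n) - verb S n.+1 *: ('X * S n).
Proof.
rewrite {1}szego revpolyB revpolyZ conjCK revpolyXM ?opuc_size //.
by rewrite revpolyS_revpoly ?opuc_size.
Qed.

Lemma opuc_norm_gt0 n : 0 < ip (S n) (S n).
Proof. exact/(ip_gt0 mu_circle mu_nontrivial)/opuc_neq0. Qed.

(** Pythagoras for z S_n, written by the Szego recursion as a sum of two orthogonal terms:
    multiplication by z and reversal preserve the norm. *)
Lemma opuc_normS n : ip (S n.+1) (S n.+1) =
  (1 - verb S n.+1 * (verb S n.+1)^*) * ip (S n) (S n).
Proof.
have szr : (size (revpoly n (S n)) <= n.+1)%N by exact: size_revpoly.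
have XS : 'X * S n = S n.+1 + (verb S n.+1)^* *: revpoly n (S n).
  by rewrite szego subrK.
have := ipXX mu (S n) (S n).
rewrite {1 2}XS ipDr !ipDl !ipZl !ipZr ip_revpoly ?opuc_size // conjCK.
rewrite (opuc_orth_lower szr) (opuc_orth_lower_l szr) => e.
apply/eqP; rewrite -subr_eq0; apply/eqP.
by rewrite -(subrr (ip (S n) (S n))) -[X in _ = X - _]e; ring.
Qed.

Lemma verb_lt1 n : verb S n.+1 * (verb S n.+1)^* < 1.
Proof.
have := opuc_norm_gt0 n.+1; rewrite opuc_normS pmulr_lgt0 ?opuc_norm_gt0 //.
by rewrite subr_gt0.
Qed.

Lemma ip_monic n p : p \is monic -> size p = n.+1 ->
  ip (S n) p = ip (S n) (S n).
Proof.
rewrite monicE lead_coefE => + sp; rewrite sp /= => /eqP pn.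
rewrite -[p](subrK (S n)) ipDr opuc_orth_lower_l ?add0r //.
apply/leq_sizeP => j; rewrite leq_eqVlt => /predU1P[<-|nj]; rewrite coefB.
  have := opuc_monic n; rewrite monicE lead_coefE opuc_size /= => /eqP ->.
  by rewrite pn subrr.
by rewrite !nth_default ?subrr ?sp ?opuc_size.
Qed.

Lemma ip_revpoly1 n : ip 1 (revpoly n (S n)) = ip (S n) (S n).
Proof.
(* Undoing the reversal leaves the product of [S n] with the monic polynomial z^n. *)
have -> : (1 : {poly R[i]}) = revpoly n 'X^n.
  apply/polyP => i; rewrite coef_revpoly coefXn coef1.
  have [->|i0] := posnP i; first by rewrite subn0 eqxx conjC1.
  case: leqP => // lin; rewrite -[n in _ == n]subn0 eqn_sub2lE //.
  by rewrite (gtn_eqF i0) conjC0.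
by rewrite ip_revpoly ?opuc_size ?size_polyXn // ip_monic ?monicXn ?size_polyXn.
Qed.

Lemma ip1_XS n : ip 1 ('X * S n) = (verb S n.+1)^* * ip (S n) (S n).
Proof.
have -> : 'X * S n = S n.+1 + (verb S n.+1)^* *: revpoly n (S n).
  by rewrite szego subrK.
rewrite ipDr ipZr ip_revpoly1 (@opuc_orth_lower n.+1 1) ?add0r //.
by rewrite size_poly1.
Qed.

End opuc.

(** * The principal value functional *)

Section kernel_functional.
Context (R : realType) (mu : probability (borelC R) R).
Hypothesis mu_circle : mu (@unit_circle R) = 1%E.
Hypothesis no_atom : mu [set (1 : R[i])] = 0%E.
Local Notation T := (@unit_circle R : set (borelC R)).
Local Notation E := (cintegral mu T).
Local Notation ip := (ip mu).
Implicit Types (p q : {poly R[i]}) (w : R[i]).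

Definition dquot p := (p - p.[1]%:P) %/ ('X - 1%:P).

Lemma dquotE p : p = p.[1]%:P + ('X - 1%:P) * dquot p.
Proof.
have d : ('X - 1%:P) %| (p - p.[1]%:P).
  by rewrite dvdp_XsubCl /root hornerD hornerN hornerC subrr.
by rewrite [_ * _]mulrC (divpK d) addrC subrK.
Qed.

Lemma horner_dquot p z : p.[z] = p.[1] + (z - 1) * (dquot p).[z].
Proof.
by rewrite {1}[p]dquotE hornerD hornerM hornerXsubC hornerC.
Qed.

Lemma dquot_unique p q c : p = c%:P + ('X - 1%:P) * q -> dquot p = q.
Proof.
move=> pE; have p1 : p.[1] = c.
  by rewrite pE hornerD hornerM hornerXsubC hornerC subrr mul0r addr0.
have X0 : 'X - 1%:P != 0 :> {poly R[i]} by rewrite polyXsubC_eq0.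
by apply/(mulfI X0)/(addrI c%:P); rewrite -pE -p1 -dquotE.
Qed.

(* The principal value of [p] against the kernel, when [w] is that of [1];
   taking [w = I + i t] adds [i t p(1)]. *)
Definition kerf w p := p.[1] * w + ip 1 ('X * dquot p).

Lemma kerfB w p q : kerf w (p - q) = kerf w p - kerf w q.
Proof.
rewrite /kerf (@dquot_unique (p - q) (dquot p - dquot q) (p.[1] - q.[1])).
  by rewrite mulrBr ipBr hornerD hornerN; ring.
by rewrite {1}[p]dquotE {1}[q]dquotE rmorphB /=; ring.
Qed.

Lemma kerfD w p q : kerf w (p + q) = kerf w p + kerf w q.
Proof.
rewrite /kerf (@dquot_unique (p + q) (dquot p + dquot q) (p.[1] + q.[1])).
  by rewrite mulrDr ipDr hornerD; ring.
by rewrite {1}[p]dquotE {1}[q]dquotE rmorphD /=; ring.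
Qed.

Lemma kerfZ w c p : kerf w (c *: p) = c * kerf w p.
Proof.
rewrite /kerf (@dquot_unique (c *: p) (c *: dquot p) (c * p.[1])).
  by rewrite -scalerAr ipZr hornerZ; ring.
by rewrite {1}[p]dquotE rmorphM /= -!mul_polyC; ring.
Qed.

Lemma kerf1 w : kerf w 1 = w.
Proof.
rewrite /kerf (@dquot_unique 1 0 1) ?mulr0 ?ip0r ?addr0 ?hornerC ?mul1r //.
Qed.

Lemma kerfXM w p : kerf w ('X * p) = kerf w p + ip 1 ('X * p).
Proof.
rewrite /kerf (@dquot_unique ('X * p) (dquot p + p) p.[1]).
  by rewrite mulrDr ipDr hornerM hornerX mul1r addrA.
by rewrite [(_ - _) * _]mulrDr addrA -dquotE polyC1; ring.
Qed.

(** Both integrals are limits over arcs that avoid 1, where f and g agree. *)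
Lemma eq_circle_integral_off1 f g : bmeas f -> bmeas g ->
  (forall z, T z -> z != 1 -> f z = g z) -> E f = E g.
Proof.
move=> bf bg fg; have lf := cvg_pv_trunc no_atom bf.
apply: (cvg_unique (@norm_hausdorff _ R[i]^o) lf).
apply: cvg_trans (cvg_pv_trunc no_atom bg); apply: near_eq_cvg; near=> x.
have xpi : 0 < x <= pi by near: x; exact: near_arc_bounds.
apply: eq_cintegral => z Az; rewrite fg //; first exact: arc_circle Az.
by apply: contra_not_neq (arc_neq1 xpi) => <-.
Unshelve. all: by end_near. Qed.

(* On the circle the kernel [k] satisfies [conj k = 1 - k], whence
   [conj (p k) + z^n conj(p) k = conj(p) (1 + (z^n - 1) k)]. *)
Lemma kerf_conj w n p : w + w^* = 1 -> (size p <= n.+1)%N ->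
  (kerf w p)^* + kerf w (revpoly n p) = E (fun z => (p.[z])^* * geom n.+1 z).
Proof.
move=> ww sp.
have bX q : bmeas (fun z => z * q.[z]).
  by apply: bmeasM; [exact: bmeas_id|exact: bmeas_horner].
have ip1 q : ip 1 ('X * q) = E (fun z => z * q.[z]).
  by apply: eq_cintegral => z _; rewrite hornerM hornerX hornerC conjC1 mul1r.
have bJ q : bmeas (fun z => (q.[z])^*) by apply: bmeasJ; exact: bmeas_horner.
have bg m q : bmeas (fun z => (q.[z])^* * geom m z).
  by apply: bmeasM => //; exact: bmeas_geom.
have rev1 : (revpoly n p).[1] = (p.[1])^*.
  rewrite horner_revpoly_circle ?expr1n ?mul1r //.
  by rewrite /unit_circle /= normr1.
(* Off 1, put z^n = 1 + (z - 1) [geom n z] into z^n conj(p) - conj(p(1)); since conj(z) - 1 = - (z -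
   1) / z, the remaining quotient of conj(p) - conj(p(1)) contributes - conj(dquot p). *)
have q'E : E (fun z => z * (dquot (revpoly n p)).[z]) =
    E (fun z => z * ((p.[z])^* * geom n z) - ((dquot p).[z])^*).
  apply: eq_circle_integral_off1 => //.
    by apply: bmeasB => //; apply: bmeasM => //; exact: bmeas_id.
  move=> z Tz z1; have z1' : z - 1 != 0 by rewrite subr_eq0.
  have z0 := circle_neq0 Tz.
  have e1 := horner_dquot (revpoly n p) z.
  rewrite rev1 horner_revpoly_circle // in e1.
  have e2 := congr1 (fun x => x^*) (horner_dquot p z).
  rewrite /= rmorphD rmorphM rmorphB rmorph1 /= -(circle_inv Tz) in e2.
  have e3 := geomE n z.
  apply: (mulfI z1').
  have -> : (z - 1) * (z * (dquot (revpoly n p)).[z]) =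
      z * (z ^+ n * (p.[z])^* - (p.[1])^*) by rewrite e1; ring.
  have -> : z ^+ n = (z - 1) * geom n z + 1 by rewrite e3 subrK.
  transitivity (z * ((z - 1) * geom n z * (p.[z])^*) +
     z * ((p.[z])^* - (p.[1])^*)); first by ring.
  by rewrite [X in _ + _ * (X - _)]e2; field.
rewrite /kerf rev1 !ip1 q'E rmorphD rmorphM /=.
rewrite circle_integralB //; last first.
  by apply: bmeasM => //; exact: bmeas_id.
have -> : (E (fun z => z * (dquot p).[z]))^* =
    E (fun z => (z * (dquot p).[z])^*).
  by rewrite circle_integral_conj.
have gE : E (fun z => (p.[z])^* * geom n.+1 z) =
    E (fun z => z * ((p.[z])^* * geom n z)) + E (fun z => (p.[z])^*).
  rewrite -circle_integralD //; last by apply: bmeasM => //; exact: bmeas_id.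
  apply: eq_cintegral => z _; rewrite /geom big_ord_recl expr0.
  under eq_bigr do rewrite /= /bump /= add1n exprS.
  by rewrite -mulr_sumr; ring.
have pE : E (fun z => (p.[z])^*) =
    (p.[1])^* + (E (fun z => (z * (dquot p).[z])^*)
                 - E (fun z => ((dquot p).[z])^*)).
  rewrite -[X in X + _](circle_integral_cst _ mu_circle).
  rewrite -circle_integralB ?bJ //; last exact: bmeasJ.
  rewrite -circle_integralD //; [|exact: bmeas_cst|].
    apply: eq_cintegral => z _.
    by rewrite [in LHS]horner_dquot !rmorphD !rmorphM rmorphB /= rmorph1; ring.
  by apply: bmeasB => //; exact: bmeasJ.
have p1E : (p.[1])^* * w + (p.[1])^* * w^* = (p.[1])^*.
  by rewrite -mulrDr ww mulr1.
rewrite gE pE -[X in _ = _ + (X + _)]p1E; ring.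
Qed.

(** On the circle z^-m is 1 minus the sum over j < m of (z - 1) z^(-j-1), by telescoping. The
    factors z - 1 cancel the kernel, so dividing by z^m only costs ordinary moments. *)
Lemma cvg_pv_laurent (c : R[i]) p m :
  pv_trunc mu (fun z => z / (z - 1)) x @[x --> 0^'+] --> (c : R[i]^o) ->
  pv_trunc mu (fun z => p.[z] / z ^+ m * (z / (z - 1))) x @[x --> 0^'+] -->
  (kerf c p - \sum_(j < m) ip 'X^j p : R[i]^o).
Proof.
move=> ck.
pose h z := (dquot p).[z] - \sum_(j < m) p.[z] / z ^+ j.+1.
have bterm j : bmeas (fun z => p.[z] / z ^+ j).
  by apply: bmeasM; [exact: bmeas_horner|exact: bmeas_exprV].
have [bsum _] := circle_integral_sum mu m (fun j => bterm j.+1).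
have [bsum0 sumE] := circle_integral_sum mu m bterm.
have bh : bmeas h by apply: bmeasB => //; exact: bmeas_horner.
have -> : kerf c p - \sum_(j < m) ip 'X^j p = p.[1] * c + E (fun z => z * h z).
  rewrite /kerf -addrA; congr (_ + _).
  rewrite (eq_bigr (fun j : 'I_m => E (fun z => p.[z] / z ^+ j))); last first.
    move=> j _; apply: eq_cintegral => z Tz.
    by rewrite hornerXn rmorphXn /= -(circle_inv Tz) exprVn mulrC.
  rewrite -sumE -circle_integralB //; last first.
    by apply: bmeasM; [apply: bmeasJ|]; exact: bmeas_horner.
  apply: eq_cintegral => z Tz; have z0 := circle_neq0 Tz.
  rewrite hornerC conjC1 mul1r hornerM hornerX /h mulrBr mulr_sumr.
  congr (_ - _); apply: eq_bigr => j _; rewrite exprS; field.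
  by rewrite z0 expf_neq0.
apply: cvg_pv_regular => // z Tz z1; have z0 := circle_neq0 Tz.
rewrite /h mulrBr mulr_sumr addrA -horner_dquot.
elim: m {bh bsum bsum0 sumE h} => [|m IH]; first by rewrite big_ord0 subr0
  expr0 divr1.
rewrite big_ord_recr /= opprD addrA -IH exprS; field.
by rewrite z0 expf_neq0.
Qed.

End kernel_functional.

(** * The functional on the orthogonal polynomials *)

Section kernel_opuc.
Context (R : realType) (mu : probability (borelC R) R).
Hypothesis mu_circle : mu (@unit_circle R) = 1%E.
Hypothesis mu_nontrivial : nontrivial mu.
Hypothesis no_atom : mu [set (1 : R[i])] = 0%E.
Variable S : nat -> {poly R[i]}.
Hypothesis S_opuc : monic_opuc mu S.
Variable w : R[i].
Hypothesis ww : w + w^* = 1.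
Local Notation ip := (ip mu).
Local Notation W n := (kerf mu w (S n)).
Implicit Types (p q : {poly R[i]}) (n : nat).

Definition gpoly n : {poly R[i]} := \sum_(k < n) 'X^k.

Lemma horner_gpoly n z : (gpoly n).[z] = geom n z.
Proof. by rewrite horner_sum; apply: eq_bigr => k _; rewrite hornerXn. Qed.

Lemma coef_gpoly n k : (gpoly n)`_k = (k < n)%:R.
Proof.
elim: n => [|n IH]; first by rewrite /gpoly big_ord0 coef0.
rewrite /gpoly big_ord_recr /= coefD -/(gpoly n) IH coefXn ltnS.
by case: ltngtP => _; rewrite ?addr0 ?add0r.
Qed.

Lemma size_gpoly n : size (gpoly n.+1) = n.+1.
Proof.
apply/eqP; rewrite eqn_leq; apply/andP; split.
  by apply/leq_sizeP => j nj; rewrite coef_gpoly ltnNge nj.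
rewrite ltnNge; apply/negP => /leq_sizeP/(_ n (leqnn n))/eqP.
by rewrite coef_gpoly ltnSn oner_eq0.
Qed.

Lemma gpoly_monic n : gpoly n.+1 \is monic.
Proof. by rewrite monicE lead_coefE size_gpoly coef_gpoly ltnSn. Qed.

Lemma revpoly_gpoly n : revpoly n (gpoly n.+1) = gpoly n.+1.
Proof.
apply/polyP => i; rewrite coef_revpoly !coef_gpoly !ltnS leq_subr conjC1.
by case: leqP.
Qed.

Lemma ip_gpoly p n : ip p (gpoly n) =
  cintegral mu (@unit_circle R) (fun z => (p.[z])^* * geom n z).
Proof. by apply: eq_cintegral => z _; rewrite horner_gpoly. Qed.

(* [1 + ... + z^n] is its own reversal, so [kerf_conj] gives the real part. *)
Lemma kerf_gpoly n : complex.Re (kerf mu w (gpoly n)) =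
  complex.Re (ip (gpoly n) (gpoly n)) / 2.
Proof.
case: n => [|n].
  rewrite /gpoly big_ord0 ip0r -(scale0r 0) kerfZ mul0r /=.
  by rewrite mul0r.
have := kerf_conj mu_circle no_atom ww (_ : (size (gpoly n.+1) <= n.+1)%N).
rewrite size_gpoly revpoly_gpoly -ip_gpoly => /(_ (leqnn _)) <-.
by rewrite [X in _ = X / _]ReD ReJ; field.
Qed.

Lemma kerf_opuc0 : W 0 = w.
Proof. by rewrite (opuc0 S_opuc) kerf1. Qed.

(** In [kerf_conj] the right side is the product of [S n] with 1 + ... + z^n, which is monic of
    degree n. *)
Lemma kerf_opuc_rev n : kerf mu w (revpoly n (S n)) = ip (S n) (S n) - (W n)^*.
Proof.
have := kerf_conj mu_circle no_atom ww (_ : (size (S n) <= n.+1)%N).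
rewrite (opuc_size S_opuc) => /(_ (leqnn _)); rewrite -ip_gpoly.
rewrite (ip_monic S_opuc (gpoly_monic n) (size_gpoly n)) => <-.
by rewrite addrC addKr.
Qed.

(** Applied to the Szego recursion, z S_n and the reversal each produce conj(alpha_n) times the
    squared norm of [S n]; these cancel. *)
Lemma kerf_opucS n : W n.+1 = W n + (verb S n.+1)^* * (W n)^*.
Proof.
rewrite {1}(szego mu_circle mu_nontrivial S_opuc) kerfB kerfXM kerfZ.
rewrite kerf_opuc_rev (ip1_XS mu_circle mu_nontrivial S_opuc).
by ring.
Qed.

(** A zero at n+1 would force |W_n| = |alpha_n| |W_n| with |alpha_n| < 1, and W_0 = w has real part
    1/2. *)
Lemma kerf_opuc_neq0 n : W n != 0.
Proof.
elim: n => [|n IH].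
  rewrite kerf_opuc0; apply: contra_eq_neq ww => ->.
  by rewrite conjC0 addr0 eq_sym oner_eq0.
rewrite kerf_opucS addr_eq0; apply: contraTneq IH => We.
have h : W n * (W n)^* =
    (verb S n.+1 * (verb S n.+1)^*) * (W n * (W n)^*).
  transitivity ((- ((verb S n.+1)^* * (W n)^*)) *
    (- ((verb S n.+1)^* * (W n)^*))^*); first by rewrite -We.
  move: (verb S n.+1) (W n) => a x.
  by rewrite rmorphN rmorphM /= !conjCK; ring.
apply/negP => W0; have WW : W n * (W n)^* != 0.
  by rewrite mulf_neq0 // conjC_eq0.
have := verb_lt1 mu_circle mu_nontrivial S_opuc n.
rewrite -[ltLHS]mulr1 -(divff WW) mulrA -h divff //; first by rewrite ltxx.
Qed.

Definition kerf_sqr n : R := complex.Re (W n * (W n)^* / ip (S n) (S n)).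

Let ip_real p : (complex.Re (ip p p))%:C = ip p p.
Proof. by rewrite RRe_real // ger0_real // ip_ge0. Qed.

Lemma Re_ip_gt0 n : 0 < complex.Re (ip (S n) (S n)).
Proof.
by rewrite -ltcR ip_real (opuc_norm_gt0 mu_circle mu_nontrivial S_opuc).
Qed.

Lemma kerf_sqrE n : (kerf_sqr n)%:C = W n * (W n)^* / ip (S n) (S n).
Proof.
rewrite /kerf_sqr RRe_real // ger0_real // divr_ge0 ?ip_ge0 //.
by rewrite -normCK exprn_ge0.
Qed.

Lemma kerf_sqr_gt0 n : 0 < kerf_sqr n.
Proof.
rewrite -ltcR kerf_sqrE divr_gt0 //.
  by rewrite -normCK exprn_gt0 // normr_gt0 kerf_opuc_neq0.
exact: (opuc_norm_gt0 mu_circle mu_nontrivial S_opuc).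
Qed.

Lemma kerf_sum n (c : nat -> R[i]) : kerf mu w (\sum_(k < n) c k *: S k) =
  \sum_(k < n) c k * W k.
Proof.
elim: n => [|n IH]; first by rewrite !big_ord0 -(scale0r 0) kerfZ mul0r.
by rewrite !big_ord_recr /= kerfD kerfZ IH.
Qed.

Lemma ip_sum_sqr n (c : nat -> R[i]) (p := \sum_(k < n) c k *: S k) :
  ip p p = \sum_(k < n) c k * (c k)^* * ip (S k) (S k).
Proof.
rewrite {}/p; elim: n => [|n IH]; first by rewrite !big_ord0 ip0r.
rewrite !big_ord_recr /= ipDr !ipDl IH -addrA; congr (_ + _).
rewrite ipZl !ipZr ipZl.
have zero : ip (S n) (\sum_(k < n) c k *: S k) = 0.
  rewrite ip_sumr big1 // => k _.
  by rewrite (opuc_orth S_opuc) ?mulr0 //; apply/eqP; rewrite gtn_eqF.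
by rewrite [ip (\sum_(k < n) _) _]ipC zero conjC0 !mulr0 !add0r mulrA.
Qed.

(** Young's inequality term by term in the basis [S k]. The weight 1/4 must stay below the 1/2 of
    [kerf_gpoly], so that the norm can be absorbed there. *)
Lemma kerf_bound (C : R) : (forall n, \sum_(k < n) kerf_sqr k <= C) ->
  forall (b : R[i]) p, `|b| = 1 ->
  complex.Re (b * kerf mu w p) <= complex.Re (ip p p) / 4 + C.
Proof.
move=> sC b p b1; have [c pE] := opuc_expansion S_opuc (leqnn (size p)).
rewrite {}pE kerf_sum ip_sum_sqr; move: (size p) => n.
apply: le_trans (lerD (lexx _) (sC n)).
elim: n => [|n IH]; first by rewrite !big_ord0 mulr0 /= mul0r addr0.
rewrite !big_ord_recr /= mulrDr !ReD.
set A := complex.Re (\sum_(i < n) _) in IH *.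
set B := \sum_(i < n) _ in IH *.
suff step : complex.Re (b * (c n * W n)) <=
    complex.Re (c n * (c n)^* * ip (S n) (S n)) / 4 + kerf_sqr n.
  by rewrite mulrDl addrACA lerD.
rewrite -[kerf_sqr n]/(complex.Re (kerf_sqr n)%:C) kerf_sqrE -(ip_real (S n)).
have e0 := Re_ip_gt0 n; move: (complex.Re (ip _ _)) e0 => e e0.
have bb : b * b^* = 1 by rewrite -normCK b1 expr1n.
move: (c n) (W n) => u v.
rewrite -fmorphV.
have -> : complex.Re (u * u^* * e%:C) / 4 + complex.Re (v * v^* * (e^-1)%:C) =
  (complex.Re (u * u^*) * e ^+ 2 / 4 + complex.Re (v * v^*)) / e.
  by rewrite !ReM /= !mulr0 !subr0; field; rewrite gt_eqF.
rewrite ler_pdivlMr //.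
have -> : complex.Re (u * u^*) = complex.Re ((b * u) * (b * u)^*).
  by rewrite rmorphM /= mulrACA bb mul1r.
rewrite mulrA; move: (b * u) => x.
rewrite !ReM !ReJ !ImJ.
(* The parts of e x / 2 - conj(v), whose squared modulus is nonnegative. *)
have := sqr_ge0 (e * complex.Re x / 2 - complex.Re v).
have := sqr_ge0 (e * complex.Im x / 2 + complex.Im v).
nra.
Qed.

End kernel_opuc.

(** * Summability and the parameter t *)

Section dichotomy.
Context (R : realType) (mu : probability (borelC R) R).
Hypothesis mu_circle : mu (@unit_circle R) = 1%E.
Hypothesis mu_nontrivial : nontrivial mu.
Hypothesis no_atom : mu [set (1 : R[i])] = 0%E.
Variable S : nat -> {poly R[i]}.
Hypothesis S_opuc : monic_opuc mu S.
Variables (c : R[i]) (t : R).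
Hypothesis ck :
  pv_trunc mu (fun z => z / (z - 1)) x @[x --> 0^'+] --> (c : R[i]^o).
Local Notation w := (c + 'i * t%:C).
Local Notation ip := (ip mu).

Lemma kernel_value_conj : w + w^* = 1.
Proof.
have c2 := Re_pv_kernel mu_circle no_atom ck.
rewrite -complexiE; apply: complex_ext.
  by rewrite !(ReD, ReJ, ReM) /= c2; field.
by rewrite !(ImD, ImJ, ImM) /=; ring.
Qed.

Lemma kerf_shift p : kerf mu w p = kerf mu c p + 'i * t%:C * p.[1].
Proof. by rewrite /kerf; ring. Qed.

Lemma kerf_young (b : R[i]) p : `|b| = 1 ->
  mu.-integrable (@unit_circle R) (fun z : borelC R => (sqdist1V z)%:E) ->
  complex.Re (b * kerf mu c p) <= (complex.Re (ip p p) +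
    \int[mu]_(z in (@unit_circle R : set (borelC R))) sqdist1V z) / 2.
Proof.
move=> b1 iJ; have := @cvg_pv_laurent _ _ no_atom c p 0%N ck.
rewrite big_ord0 subr0 (_ : (fun z => p.[z] / z ^+ 0 * _) =
  (fun z => p.[z] * (z / (z - 1)))); last first.
  by apply/funext => z; rewrite expr0 divr1.
move=> pk; rewrite [ip p p](_ : _ =
  cintegral mu (@unit_circle R) (fun z => p.[z] * (p.[z])^*)); last first.
  by apply: eq_cintegral => z _; rewrite mulrC.
apply: (pv_kernel_young (bmeas_horner (dquot p))) => //.
- by move=> z _ _; exact: horner_dquot.
- exact: bmeas_horner.
Qed.

(* Bessel's inequality for the functional represented by the kernel: test it on
   the [p] for which [kerf p] and [ip p p] both equal the partial sum. *)
Lemma kerf_sqr_summable : t = 0 ->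
  mu.-integrable (@unit_circle R) (fun z : borelC R => (sqdist1V z)%:E) ->
  exists C, forall n, \sum_(k < n) kerf_sqr mu S w k <= C.
Proof.
move=> t0 iJ; exists (\int[mu]_(z in (@unit_circle R : set (borelC R)))
  sqdist1V z).
move=> n; pose a k := (kerf mu w (S k))^* / ip (S k) (S k).
pose p := \sum_(k < n) a k *: S k.
have e0 k : ip (S k) (S k) != 0.
  by rewrite gt_eqF // (opuc_norm_gt0 mu_circle mu_nontrivial S_opuc).
have sumE : (\sum_(k < n) kerf_sqr mu S w k)%:C = kerf mu c p.
  have -> : kerf mu c p = kerf mu w p by rewrite kerf_shift t0 mulr0 mul0r
    addr0.
  rewrite kerf_sum rmorph_sum; apply: eq_bigr => k _.
  by rewrite /= kerf_sqrE /a; ring.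
have sumE' : (\sum_(k < n) kerf_sqr mu S w k)%:C = ip p p.
  rewrite (ip_sum_sqr S_opuc) rmorph_sum; apply: eq_bigr => k _.
  rewrite /= kerf_sqrE /a rmorphM /= conjCK fmorphV /= -(ipC mu (S k)).
  by field.
(* With [kerf mu c p = ip p p = sum], this reads sum <= (sum + J) / 2. *)
have := kerf_young p (normr1 _) iJ.
rewrite mul1r -sumE -sumE' /=; lra.
Qed.

Section bounded.
Variable C : R.
Hypothesis sC : forall n, \sum_(k < n) kerf_sqr mu S w k <= C.

(** [kerf_bound] gives norm / 2 <= norm / 4 + C for the squared norm. *)
Let gpoly_norm_le n : complex.Re (ip (gpoly R n) (gpoly R n)) <= 4 * C.
Proof.
have := kerf_bound mu_circle mu_nontrivial S_opuc sC (gpoly R n) (normr1 _).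
rewrite mul1r kerf_gpoly //; last exact: kernel_value_conj.
lra.
Qed.

Lemma bounded_sqdist1V_integrable :
  mu.-integrable (@unit_circle R) (fun z : borelC R => (sqdist1V z)%:E).
Proof.
apply: (@sqdist1V_integrable _ _ (4 * C)) => n.
apply: le_trans (gpoly_norm_le n); rewrite le_eqVlt; apply/orP; left; apply/eqP.
congr complex.Re; apply: eq_cintegral => z _.
by rewrite horner_gpoly mulrC.
Qed.

(* The functional is bounded both with and without the term [i t p(1)], while
   [1 + ... + z^(n-1)] has bounded norm and takes the value [n] at [1]. *)
Lemma bounded_parameter_eq0 : t = 0.
Proof.
have iJ := bounded_sqdist1V_integrable.
apply/eqP/negPn/negP => t0.
pose J := \int[mu]_(z in (@unit_circle R : set (borelC R))) sqdist1V z.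
(* b = - i sgn t turns i t n into |t| n. *)
pose b : R[i] := 0 +i* - Num.sg t.
have b1 : `|b| = 1.
  by rewrite normc_def /= expr0n add0r sqrrN sqr_sg t0 sqrtr1.
(* With squared norm at most 4 C, [kerf_bound] contributes 2 C and [kerf_young], used with - b,
   contributes 2 C + J / 2. *)
have bound n : `|t| * n%:R <= 4 * C + J / 2.
  have h1 := kerf_bound mu_circle mu_nontrivial S_opuc sC (gpoly R n) b1.
  have nb1 : `|- b| = 1 by rewrite normrN.
  have h2 := kerf_young (gpoly R n) nb1 iJ; rewrite -/J in h2.
  have h3 := gpoly_norm_le n.
  have tE : complex.Re (b * ('i * t%:C * (gpoly R n).[1])) = `|t| * n%:R.
    rewrite horner_gpoly /geom (eq_bigr (fun=> 1)); last first.
      by move=> k _; rewrite expr1n.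
    rewrite sumr_const card_ord -complexiE -(rmorph_nat (real_complex R)).
    by rewrite !(ReM, ImM) /= [`|t|]normrEsg; ring.
  have h4 : complex.Re (b * kerf mu w (gpoly R n)) =
      `|t| * n%:R - complex.Re (- b * kerf mu c (gpoly R n)).
    rewrite kerf_shift -tE; move: (kerf mu c _) ('i * _ * _) => k u.
    by rewrite mulrDr ReD mulNr ReN opprK addrC.
  lra.
have t1 : 0 < `|t| by rewrite normr_gt0.
have := truncnS_gt ((4 * C + J / 2) / `|t|).
by rewrite ltNge ler_pdivlMr // mulrC bound.
Qed.

End bounded.

End dichotomy.

(** * Para-orthogonal polynomials *)

Section para_orthogonal_parameters.
Context (R : realType).
Variables v W e rho : nat -> R[i].
Hypothesis v0 : v 0%N = -1.
Hypothesis v_lt1 : forall n, v n.+1 * (v n.+1)^* < 1.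
Hypothesis W0 : W 0%N + (W 0%N)^* = 1.
Hypothesis W_neq0 : forall n, W n != 0.
Hypothesis WS : forall n, W n.+1 = W n + (v n.+1)^* * (W n)^*.
Hypothesis e_neq0 : forall n, e n != 0.
Hypothesis eS : forall n, e n.+1 = (1 - v n.+1 * (v n.+1)^*) * e n.
Hypothesis rho_0 : rho 0%N = - (W 0%N / (W 0%N)^*).
Hypothesis rho_rec : forall n, (1 <= n)%N ->
  rho n = (rho n.-1 - (v n)^*) / (1 - rho n.-1 * v n).
Variable s : nat -> R.
Hypothesis sE : forall n, (s n)%:C = W n * (W n)^* / e n.
Local Notation a n := (rho n * v n).

Let WJ_neq0 n : (W n)^* != 0.
Proof. by rewrite conjC_eq0. Qed.

Let WSJ n : (W n.+1)^* = (W n)^* + v n.+1 * W n.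
Proof. by rewrite WS rmorphD rmorphM /= !conjCK. Qed.

Lemma rhoE n : rho n = - (W n / (W n)^*).
Proof.
elim: n => [|n IH]; first exact: rho_0.
have := WJ_neq0 n.+1; have := WJ_neq0 n; rewrite rho_rec //= IH WSJ WS.
move: (W n) (W n)^* (v _) (v _)^* => x y u uJ y0 z0.
by field; rewrite y0 z0.
Qed.

Lemma rho_norm n : `|rho n| = 1.
Proof. by rewrite rhoE normrN normrM normfV norm_conjC divff ?normr_eq0. Qed.

Lemma rho_mulJ n : rho n * (rho n)^* = 1.
Proof. by rewrite -normCK rho_norm expr1n. Qed.

Lemma rho_verb_norm n : a n * (a n)^* = v n * (v n)^*.
Proof. by rewrite rmorphM /= mulrACA rho_mulJ mul1r. Qed.

(** The recursion for [rho] solved for its previous value and cleared of the division. *)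
Lemma rho_step n : (1 + a n.+1) * rho n = rho n.+1 + (v n.+1)^*.
Proof.
have := WJ_neq0 n; have := WJ_neq0 n.+1; rewrite !rhoE (WSJ n) (WS n).
move: (W n) (W n)^* (v n.+1) (v n.+1)^* => x y u uJ y0 x0.
by field; rewrite x0 y0.
Qed.

(** The bridge between [rho] and [W]: it yields both the nonvanishing of 1 + a and, in squared
    modulus, the ratio of consecutive [s]. *)
Lemma add1_rho_verb n : (1 + a n.+1) * (W n.+1)^* =
  (1 - v n.+1 * (v n.+1)^*) * (W n)^*.
Proof.
have := WJ_neq0 n.+1; rewrite (rhoE n.+1) (WSJ n) (WS n).
move: (W n) (W n)^* (v n.+1) (v n.+1)^* => x y u uJ y0.
by field.
Qed.

Lemma add1_rho_verb_neq0 n : 1 + a n != 0.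
Proof.
case: n => [|n].
  rewrite rhoE v0 mulrN1 opprK; apply/eqP => h.
  have := oner_neq0 R[i]; rewrite -W0.
  have -> : W 0%N + (W 0%N)^* = (1 + W 0%N / (W 0%N)^*) * (W 0%N)^*.
    by field; exact: WJ_neq0.
  by rewrite h mul0r eqxx.
apply/eqP => h; have := add1_rho_verb n; rewrite h mul0r => /esym/eqP.
rewrite mulf_eq0 (negPf (WJ_neq0 n)) orbF subr_eq0 => /eqP v1.
by have := v_lt1 n; rewrite -v1 ltxx.
Qed.

Lemma rho_verb_le1 n : a n * (a n)^* <= 1.
Proof.
rewrite rho_verb_norm; case: n => [|n].
  by rewrite v0 rmorphN1 mulrNN mulr1.
exact/ltW/v_lt1.
Qed.

(** In the closed unit disc the real part -1 is attained only at -1, which [add1_rho_verb_neq0]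
    excludes. *)
Lemma add1_Re_gt0 n : 0 < 1 + complex.Re (a n).
Proof.
have := rho_verb_le1 n; have := add1_rho_verb_neq0 n; move: (a n) => u u1 u2.
have : complex.Re (u * u^*) <= 1 by move: u2; rewrite lecE => /andP[].
rewrite Re_mulJ => u3.
rewrite lt_neqAle; apply/andP; split; last first.
  have := sqr_ge0 (complex.Im u); have := sqr_ge0 (complex.Re u + 1); nra.
apply: contra_neq u1 => h.
have r1 : complex.Re u = -1 by lra.
have i1 : complex.Im u = 0.
  apply/eqP; rewrite -sqrf_eq0 eq_le sqr_ge0 andbT; move: u3; rewrite r1; nra.
by apply: complex_ext; rewrite (ReD, ImD) /= ?r1 ?i1 ?subrr ?addr0.
Qed.

Definition minpar n : R := (1 - (complex.Re (a n) ^+ 2 + complex.Im (a n) ^+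
  2)) /
  (2 * (1 + complex.Re (a n))).

Lemma minparE n : (minpar n)%:C = 2^-1 * ((1 - `|a n| ^+ 2) /
  (1 + (complex.Re (a n))%:C)).
Proof.
rewrite -add_Re2_Im2 /minpar; move: (lt0r_neq0 (add1_Re_gt0 n)).
move: (complex.Re _) (complex.Im _) => x y x0.
have -> : (1 - (x ^+ 2 + y ^+ 2)) / (2 * (1 + x)) =
  2^-1 * ((1 - (x ^+ 2 + y ^+ 2)) / (1 + x)) by field.
rewrite rmorphM fmorphV rmorph_nat /=.
by rewrite rmorphM /= fmorphV rmorphB !rmorphD !rmorph1.
Qed.

(** alpha_(-1) = -1 has modulus one; this makes the parameter sequence minimal. *)
Lemma minpar0 : minpar 0 = 0.
Proof.
rewrite /minpar; have := congr1 (@complex.Re R) (rho_verb_norm 0).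
rewrite Re_mulJ => ->.
by rewrite v0 rmorphN1 mulrNN mulr1 /= subrr mul0r.
Qed.

Lemma minpar_gt0 n : 0 < minpar n.+1.
Proof.
rewrite divr_gt0 ?mulr_gt0 ?add1_Re_gt0 // subr_gt0.
have := v_lt1 n.
rewrite -rho_verb_norm ltcE => /andP[_].
by rewrite Re_mulJ.
Qed.

Lemma sub1_minpar n : 1 - minpar n =
  ((1 + complex.Re (a n)) ^+ 2 + complex.Im (a n) ^+ 2) /
  (2 * (1 + complex.Re (a n))).
Proof. by rewrite /minpar; have := lt0r_neq0 (add1_Re_gt0 n) => h; field. Qed.

Lemma minpar_lt1 n : minpar n < 1.
Proof.
rewrite -subr_gt0 sub1_minpar divr_gt0 ?mulr_gt0 ?add1_Re_gt0 //.
by rewrite ltr_wpDr ?sqr_ge0 // exprn_gt0 // add1_Re_gt0.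
Qed.

(** m / (1 - m) is (1 - |a|^2) / |1 + a|^2, and [add1_rho_verb] together with [eS] evaluates |1 +
    a|^2. This is the relation required by [sppcs_divergent_sum]. *)
Lemma minpar_step n : minpar n.+1 * s n = (1 - minpar n.+1) * s n.+1.
Proof.
have D0 := lt0r_neq0 (add1_Re_gt0 n.+1).
have key : (1 - (complex.Re (a n.+1) ^+ 2 + complex.Im (a n.+1) ^+ 2)) * s n =
    ((1 + complex.Re (a n.+1)) ^+ 2 + complex.Im (a n.+1) ^+ 2) * s n.+1.
  have lE : (1 - (complex.Re (a n.+1) ^+ 2 + complex.Im (a n.+1) ^+ 2))%:C =
      1 - v n.+1 * (v n.+1)^*.
    by rewrite rmorphB rmorph1 /= add_Re2_Im2 normCK rho_verb_norm.
  have rE : ((1 + complex.Re (a n.+1)) ^+ 2 + complex.Im (a n.+1) ^+ 2)%:C =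
      (1 + a n.+1) * (1 + a n.+1)^*.
    by rewrite -normCK -add_Re2_Im2 ReD ImD /= add0r.
  apply: complexI; rewrite [LHS]rmorphM [RHS]rmorphM /= !sE lE rE eS.
  have k1 := add1_rho_verb n; have k2 := congr1 (fun x => x^*) k1.
  rewrite /= [in LHS]rmorphM [in RHS]rmorphM rmorphB rmorph1 rmorphM /= !conjCK
    in k2.
  have v1 : 1 - v n.+1 * (v n.+1)^* != 0 by rewrite subr_eq0 eq_sym lt_eqF.
  have := e_neq0 n; move: k1 k2 v1.
  move: (1 + a n.+1) (W n.+1) (W n) (e n) => A x y E.
  move: A^* x^* y^* => AJ xJ yJ; rewrite [(v n.+1)^* * _]mulrC.
  move: (1 - v n.+1 * _) => V k1 k2 V0 E0.
  rewrite (_ : A * AJ * _ = A * xJ * (AJ * x) / (V * E)); last by field;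
    rewrite V0 E0.
  by rewrite k1 k2; field; rewrite E0.
rewrite sub1_minpar /minpar mulrAC key; ring.
Qed.

(** This is c_(n+1); n = 0 gives c_1, since [a 0 = - rho 0]. *)
Definition recur_c n : R := - complex.Im (a n) / (1 + complex.Re (a n)).

Lemma add1_ReC n : 1 + (complex.Re (a n))%:C = (1 + complex.Re (a n))%:C.
Proof. by rewrite rmorphD rmorph1. Qed.

Lemma add1_ReC_neq0 n : 1 + (complex.Re (a n))%:C != 0.
Proof. by rewrite add1_ReC gt_eqF // ltcR add1_Re_gt0. Qed.

(** The inverse of the n-th factor of [para_scale]: that normalisation is what makes the
    coefficients of the recurrence 1 + ic and 1 - ic. *)
Lemma add1_icE n : 1 + 'i * (recur_c n)%:C =
  (1 + (a n)^*) / (1 + (complex.Re (a n))%:C).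
Proof.
apply: (canRL (mulfK (add1_ReC_neq0 n))).
have := lt0r_neq0 (add1_Re_gt0 n); rewrite /recur_c add1_ReC -complexiE.
move: (a n) => u u0; apply: complex_ext.
  by rewrite !(ReM, ImM, ReD, ImD, ReJ) /=; field.
by rewrite !(ReM, ImM, ReD, ImD, ImJ) /=; field.
Qed.

Lemma sub1_icE n : 1 - 'i * (recur_c n)%:C =
  (1 + a n) / (1 + (complex.Re (a n))%:C).
Proof.
apply: (canRL (mulfK (add1_ReC_neq0 n))).
have := lt0r_neq0 (add1_Re_gt0 n); rewrite /recur_c add1_ReC -complexiE.
move: (a n) => u u0; apply: complex_ext.
  by rewrite !(ReM, ImM, ReD, ImD, ReN, ImN) /=; field.
by rewrite !(ReM, ImM, ReD, ImD, ReN, ImN) /=; field.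
Qed.

Lemma minpar_norm n : 2 * (minpar n)%:C =
  (1 - a n * (a n)^*) / (1 + (complex.Re (a n))%:C).
Proof. by rewrite minparE normCK mulrA divff ?mul1r ?pnatr_eq0. Qed.

Lemma sub1_minpar_norm n : 2 * (1 - minpar n)%:C =
  (1 + a n) * (1 + (a n)^*) / (1 + (complex.Re (a n))%:C).
Proof.
have D0 := add1_ReC_neq0 n; rewrite rmorphB rmorph1 mulrBr minpar_norm.
apply: (canRL (mulfK D0)); rewrite mulrBl divfK //.
have -> : 2 * 1 * (1 + (complex.Re (a n))%:C) = 2 + (a n + (a n)^*).
  by rewrite [a n + _]addcJ; ring.
ring.
Qed.

Variables P Pr : nat -> {poly R[i]}.
Hypothesis P_0 : P 0%N = 1.
Hypothesis Pr_0 : Pr 0%N = 1.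
Hypothesis PS : forall n, P n.+1 = 'X * P n - (v n.+1)^* *: Pr n.
Hypothesis PrS : forall n, Pr n.+1 = Pr n - v n.+1 *: ('X * P n).

(** The value 1 at n = 0 makes [para_polyE] hold there too. *)
Definition para_poly n : {poly R[i]} :=
  if n is k.+1 then 'X * P k - rho k *: Pr k else 1.

Definition para_scale n : R[i] :=
  \prod_(k < n) ((1 + (complex.Re (a k))%:C) / (1 + (a k)^*)).

Lemma add1_rho_verbJ_neq0 n : 1 + (a n)^* != 0.
Proof. by rewrite -(conjC1 R[i]) -rmorphD conjC_eq0 add1_rho_verb_neq0. Qed.

Lemma para_scale_neq0 n : para_scale n != 0.
Proof.
apply/prodf_neq0 => k _.
by rewrite mulf_neq0 ?invr_eq0 ?add1_ReC_neq0 ?add1_rho_verbJ_neq0.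
Qed.

(** The same polynomial, up to a factor, is built on index n - 1 and on index n; the second form is
    what [para_orthogonal_recurrence] produces in its last term. *)
Lemma para_polyE n : (1 + a n) *: para_poly n = P n - rho n *: Pr n.
Proof.
case: n => [|n].
  by rewrite P_0 Pr_0 v0 mulrN1 /= scalerBl scale1r.
rewrite /= scalerBr scalerA rho_step PS PrS -!mul_polyC !rmorphD !rmorphM /=.
by rewrite rmorph1; ring.
Qed.

Lemma para_poly_recurrence n : para_poly n.+2 =
  ('X + ((1 + a n.+1) / (1 + (a n.+1)^*))%:P) * para_poly n.+1 -
  ((1 - a n.+1 * (a n.+1)^*) / (1 + (a n.+1)^*) * (1 + a n)) *:
    ('X * para_poly n).
Proof.
rewrite -[_ *: ('X * _)]scalerA scalerAr para_polyE.
have J0 := add1_rho_verbJ_neq0 n.+1.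
have aJ : rho n.+1 * (a n.+1)^* = (v n.+1)^*.
  by rewrite rmorphM /= mulrA rho_mulJ mul1r.
have r1 := rho_step n.
rewrite {1}/para_poly PS PrS; apply: para_orthogonal_recurrence.
- by apply: (mulIf J0); rewrite mulrBl !divfK //; ring.
- apply: (mulIf J0); rewrite mulrAC mulrBl mul1r divfK //.
  transitivity ((a n.+1)^* * ((1 + a n.+1) * rho n)); first ring.
  by rewrite r1 -aJ; ring.
- apply: (mulIf J0); rewrite mulrAC divfK // r1 -aJ; ring.
Qed.

(** [K], [B], [A] stand for [para_scale] at n+2, n+1 and n; the conditions transfer the unscaled
    recurrence to [Rn]. *)
Lemma scaled_recurrence (F : fieldType) (p q : {poly F}) (K j l m B k r A : F) :
  K * j = B -> K * l = B * k -> K * m = r * A ->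
  ('X + k%:P) * (B *: p) - r *: ('X * (A *: q)) =
  K *: ((j *: 'X + l%:P) * p - m *: 'X * q).
Proof.
move=> e1 e2 e3; rewrite -!mul_polyC.
transitivity ('X * (B%:P * p) + (B * k)%:P * p - (r * A)%:P * ('X * q)).
  by rewrite !polyCM; ring.
by rewrite -e2 -e3 -e1 !polyCM; ring.
Qed.

Lemma para_recurrence (Rn : nat -> {poly R[i]}) n :
  (forall n, para_scale n *: Rn n = para_poly n) ->
  Rn n.+2 = ((1 + 'i * (recur_c n.+1)%:C) *: 'X
             + (1 - 'i * (recur_c n.+1)%:C)%:P) * Rn n.+1
            - (4 * ((1 - minpar n) * minpar n.+1)%:C) *: 'X * Rn n.
Proof.
move=> RnE; apply: (scalerI (para_scale_neq0 n.+2)).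
rewrite RnE para_poly_recurrence -!RnE add1_icE sub1_icE.
have D1 := add1_ReC_neq0 n.+1; have D0 := add1_ReC_neq0 n.
have J1 := add1_rho_verbJ_neq0 n.+1; have J0 := add1_rho_verbJ_neq0 n.
(* Each factor carries one denominator 1 + Re a, cancelled by a factor of [para_scale]. *)
have -> : 4 * ((1 - minpar n) * minpar n.+1)%:C =
    (2 * (1 - minpar n)%:C) * (2 * (minpar n.+1)%:C).
  by rewrite rmorphM /=; ring.
rewrite minpar_norm sub1_minpar_norm /para_scale !big_ord_recr /=.
move: (\prod_(k < n) _) => A.
move: (1 + (complex.Re (a n.+1))%:C) (1 + (complex.Re (a n))%:C) D1 D0 => D D'.
move: (1 + (a n.+1)^*) (1 + (a n)^*) J1 J0 => J J' J1 J0 D1 D0.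
move: (1 + a n.+1) (1 + a n) (1 - a n.+1 * _) => x x' y.
move: (Rn n.+1) (Rn n) => p q.
have e1 : A * (D' / J') * (D / J) * (J / D) = A * (D' / J') by field; rewrite
  J1 D1 J0.
have e2 : A * (D' / J') * (D / J) * (x / D) = A * (D' / J') * (x / J).
  by field; rewrite J1 D1 J0.
have e3 : A * (D' / J') * (D / J) * (x' * J' / D' * (y / D)) = A * (y / J * x').
  by field; rewrite J1 D1 J0 D0.
by apply: scaled_recurrence; [exact: e1|exact: e2|rewrite e3; ring].
Qed.

Lemma para_first (Rn : nat -> {poly R[i]}) :
  (forall n, para_scale n *: Rn n = para_poly n) ->
  Rn 1%N = (1 + 'i * (recur_c 0)%:C) *: 'X + (1 - 'i * (recur_c 0)%:C)%:P.
Proof.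
move=> RnE; apply: (scalerI (para_scale_neq0 1)).
rewrite RnE add1_icE sub1_icE /para_scale big_ord1 /= P_0 Pr_0 mulr1.
have D0 := add1_ReC_neq0 0; have J0 := add1_rho_verbJ_neq0 0.
have aE : a 0 = - rho 0%N by rewrite v0 mulrN1.
have r1 := rho_mulJ 0.
have e1 : (1 + (complex.Re (a 0%N))%:C) / (1 + (a 0%N)^*) *
    ((1 + (a 0%N)^*) / (1 + (complex.Re (a 0%N))%:C)) = 1.
  by move: (1 + _) (1 + _^*) D0 J0 => D J D0 J0; field; rewrite D0 J0.
have e2 : (1 + (complex.Re (a 0%N))%:C) / (1 + (a 0%N)^*) *
    ((1 + a 0%N) / (1 + (complex.Re (a 0%N))%:C)) = - rho 0%N.
  have -> : 1 + a 0%N = - rho 0%N * (1 + (a 0%N)^*).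
    transitivity (rho 0%N * (rho 0%N)^* - rho 0%N); first by rewrite r1 aE.
    by rewrite aE rmorphN /=; ring.
  by move: (1 + _) (1 + _^*) D0 J0 => D J D0 J0; field; rewrite D0 J0.
by rewrite scalerDr scalerA e1 scale1r alg_polyC -mul_polyC -polyCM e2 polyCN.
Qed.

End para_orthogonal_parameters.

(** By [cvg_pv_laurent] this is L at Q / z^(m+1). The moments with 1 <= j <= m vanish by
    orthogonality, and the moment j = 0 leaves W_n + r conj(W_n), which is zero exactly for this
    r. *)
Lemma para_orthogonality (R : realType) (mu : probability (borelC R) R)
    (S : nat -> {poly R[i]}) (w r : R[i]) (n m : nat) :
  mu (@unit_circle R) = 1%E -> nontrivial mu ->
  mu [set (1 : R[i])] = 0%E -> monic_opuc mu S -> w + w^* = 1 ->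
  kerf mu w (S n) != 0 ->
  r = - (kerf mu w (S n) / (kerf mu w (S n))^*) -> (m <= n)%N ->
  let Q := 'X * S n - r *: revpoly n (S n) in
  kerf mu w Q - \sum_(j < m.+1) ip mu 'X^j Q = 0.
Proof.
move=> mu1 nt na So ww W0 rE mn Q.
have Xorth (j : nat) : (1 <= j <= n)%N -> ip mu 'X^j Q = 0.
  case: j => // j jn; rewrite ipBr ipZr exprS ipXX.
  by rewrite (opuc_orth_lower So) ?(revpoly_orth So) ?mulr0 ?subrr ?size_polyXn.
rewrite big_ord_recl big1 ?addr0 => [|j _]; last first.
  by rewrite Xorth // (leq_trans _ mn) //= /bump add1n.
rewrite expr0 /Q kerfB ipBr kerfXM kerfZ ipZr.
rewrite (kerf_opuc_rev mu1 na So ww) (ip_revpoly1 So) rE.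
have W1 : (kerf mu w (S n))^* != 0 by rewrite conjC_eq0.
move: (kerf mu w (S n)) (_^*) W1 => x y y0.
by field.
Qed.

Lemma laurent_trunc (R : realType) (mu : probability (borelC R) R)
    (l : R[i] -> R[i]) (p : {poly R[i]}) (n : nat) :
  (forall z, z != 0 -> l z = p.[z] / z ^+ n) ->
  pv_trunc mu (fun z => l z * (z / (z - 1))) =
  pv_trunc mu (fun z => p.[z] / z ^+ n * (z / (z - 1))).
Proof.
move=> lE; apply/funext => x; apply: eq_cintegral => z Az.
by rewrite lE //; apply: circle_neq0; exact: arc_circle Az.
Qed.

(** With x = w and y = conj(w), this evaluates the quotient that defines c_1 as 2 i Im w. *)
Lemma cayley_ratio (F : fieldType) (x y : F) : x + y = 1 -> y != 0 ->
  (- (x / y) + 1) / (- (x / y) - 1) = x - y.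
Proof.
move=> /(canRL (addrK _)) -> y0.
have -> : - ((1 - y) / y) - 1 = - y^-1 by field.
by field; rewrite y0 ?oppr_eq0 ?invr_eq0 ?y0 ?oner_eq0.
Qed.

Theorem theorem4p2 (R : realType)
  (mu : probability (borelC R) R)
  (mu_circle : mu (@unit_circle R) = 1%E)
  (mu_nontrivial : nontrivial mu)
  (mu_no_atom_at_1 : mu [set (1 : R[i])] = 0%E)
  (I_exists : pv_exists mu (fun z => z * (z - 1)^-1))
  (I : R[i])
  (I_def : I = pv_integral mu (fun z => z * (z - 1)^-1))
  (S : nat -> {poly R[i]})
  (S_opuc : monic_opuc mu S)
  (t : R)
  (rho : nat -> R[i])
  (rho_0 : rho 0%N = - ((I + 'i * t%:C) / (I^* - 'i * t%:C)))
  (rho_rec : forall n, (1 <= n)%N ->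
     rho n = (rho n.-1 - (verb S n)^*) / (1 - rho n.-1 * verb S n))
  (Rn : nat -> {poly R[i]})
  (Rn_0 : Rn 0%N = 1)
  (Rn_def : forall n, (1 <= n)%N ->
     (\prod_(k < n) ((1 + (complex.Re (rho k * verb S k))%:C) /
                     (1 + (rho k * verb S k)^*))) *: Rn n =
     'X * S n.-1 - rho n.-1 *: revpoly n.-1 (S n.-1)) :
  (forall n, `|rho n| = 1) /\
  (exists c d m : nat -> R,
     (c 1%N)%:C = 'i * ((rho 0%N + 1) / (rho 0%N - 1)) /\
     c 1%N = - 2 * (t + complex.Im I) /\
     (forall n, (1 <= n)%N ->
        c n.+1 = - complex.Im (rho n * verb S n) /
                 (1 + complex.Re (rho n * verb S n))) /\
     (forall n, (1 <= n)%N -> d n.+1 = (1 - m n.-1) * m n) /\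
     (forall n, (m n)%:C =
        2^-1 * ((1 - `|rho n * verb S n| ^+ 2) /
                (1 + (complex.Re (rho n * verb S n))%:C))) /\
     Rn 1%N = (1 + 'i * (c 1%N)%:C) *: 'X + (1 - 'i * (c 1%N)%:C)%:P /\
     (forall n, (1 <= n)%N ->
        Rn n.+1 = ((1 + 'i * (c n.+1)%:C) *: 'X
                   + (1 - 'i * (c n.+1)%:C)%:P) * Rn n
                  - (4 * (d n.+1)%:C) *: 'X * Rn n.-1) /\
     positive_chain (fun n => d n.+1) /\
     is_min_param (fun n => d n.+1) m /\
     (t != 0 -> sppcs (fun n => d n.+1)) /\
     (t = 0 ->
        (~ sppcs (fun n => d n.+1) <->
         cintegrable mu (@unit_circle R)
           (fun z => z * (z - 1)^-1 * (1 - z)^-1)))) /\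
  (forall l, laurent_poly l ->
     pv_exists mu (fun z => l z * (z / (z - 1)))) /\
  (forall (d1 : R) (N : (R[i] -> R[i]) -> R[i]), d1 != 0 ->
     (forall l, laurent_poly l ->
        ((1 + 4 * (t + complex.Im I) ^+ 2) / (4 * d1))%:C * N l =
        pv_integral mu (fun z => l z * (z / (z - 1))) + 'i * t%:C * l 1) ->
     forall n k : nat, (k < n)%N ->
       N (fun z => z ^ (k%:Z - n%:Z) * (Rn n).[z]) = 0).
Proof.
have kI : pv_trunc mu (fun z => z / (z - 1)) x @[x --> 0^'+] --> (I : R[i]^o).
  by rewrite I_def; exact: I_exists.
pose w := I + 'i * t%:C.
have ww : w + w^* = 1 by exact: (kernel_value_conj mu_circle mu_no_atom_at_1 t
  kI).
have I2 := Re_pv_kernel mu_circle mu_no_atom_at_1 kI.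
pose W n := kerf mu w (S n).
pose v := verb S.
pose e n := ip mu (S n) (S n).
pose s := kerf_sqr mu S w.
have S0 := opuc0 S_opuc.
have v0 : v 0%N = -1 by rewrite /v /verb S0 hornerC conjC1.
have v_lt1 n : v n.+1 * (v n.+1)^* < 1.
  exact: (verb_lt1 mu_circle mu_nontrivial S_opuc).
have W0 : W 0%N = w by exact: kerf_opuc0.
have WW : W 0%N + (W 0%N)^* = 1 by rewrite W0.
have W_neq0 n : W n != 0.
  exact: (kerf_opuc_neq0 mu_circle mu_nontrivial mu_no_atom_at_1 S_opuc ww).
have WS n : W n.+1 = W n + (v n.+1)^* * (W n)^*.
  exact: (kerf_opucS mu_circle mu_nontrivial mu_no_atom_at_1 S_opuc ww).
have e_neq0 n : e n != 0.
  by rewrite gt_eqF //; exact: (opuc_norm_gt0 mu_circle mu_nontrivial S_opuc).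
have eS n : e n.+1 = (1 - v n.+1 * (v n.+1)^*) * e n.
  exact: (opuc_normS mu_circle mu_nontrivial S_opuc).
have sE n : (s n)%:C = W n * (W n)^* / e n by exact: kerf_sqrE.
have wJ : w^* = I^* - 'i * t%:C.
  rewrite rmorphD rmorphM /= conjCi mulNr; congr (_ - 'i * _).
  by rewrite conjcE /= oppr0.
have rho0 : rho 0%N = - (W 0%N / (W 0%N)^*) by rewrite rho_0 W0 wJ.
have rhoE := rhoE W_neq0 WS rho0 rho_rec.
have rho1 := rho_norm W_neq0 WS rho0 rho_rec.
have P_S n : S n.+1 = 'X * S n - (v n.+1)^* *: revpoly n (S n).
  exact: (szego mu_circle mu_nontrivial S_opuc).
have P_R n : revpoly n.+1 (S n.+1) = revpoly n (S n) - v n.+1 *: ('X * S n).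
  exact: (szego_rev mu_circle mu_nontrivial S_opuc).
have R0 : revpoly 0 (S 0%N) = 1.
  by apply/polyP => i; rewrite coef_revpoly S0 !coef1; case: i => [|i];
    rewrite ?conjC1.
have RnE n : para_scale v rho n *: Rn n = para_poly rho S (fun n => revpoly n
  (S n)) n.
  case: n => [|n]; last exact: Rn_def.
  by rewrite /para_scale big_ord0 scale1r.
split; first by [].
have orth n m : (m < n)%N -> kerf mu w (Rn n) - \sum_(j < m.+1) ip mu 'X^j (Rn
  n) = 0.
  case: n => // n mn.
  have A0 := para_scale_neq0 v0 v_lt1 WW W_neq0 WS rho0 rho_rec n.+1.
  apply: (mulfI A0); rewrite mulr0 mulrBr -kerfZ mulr_sumr.
  under eq_bigr do rewrite -ipZr.
  rewrite RnE /para_poly.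
  exact: (para_orthogonality mu_circle mu_nontrivial mu_no_atom_at_1 S_opuc ww
    (W_neq0 n) (rhoE n) mn).
have D1 := add1_Re_gt0 v0 v_lt1 WW W_neq0 WS rho0 rho_rec.
split; last split.
- pose m := minpar v rho; pose c n := recur_c v rho n.-1.
  pose d n : R := (1 - m n.-2) * m n.-1.
  have c1E : c 1%N = - 2 * (t + complex.Im I).
    have wI : complex.Im w = t + complex.Im I.
      by rewrite /w -complexiE ImD ImM /=; ring.
    have wR : complex.Re w = 2^-1.
      by rewrite /w -complexiE ReD ReM /= I2; ring.
    have := D1 0%N; rewrite /c /recur_c /= v0 mulrN1 rho0 opprK W0 => u0.
    have uw : w / w^* * w^* = w by rewrite divfK // -W0 conjC_eq0.
    (* As Re w = 1/2, the imaginary part of u conj(w) = w says Im u = 2 Im w (1 + Re u). *)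
    have := congr1 (@complex.Im R) uw.
    move: (w / w^*) u0 => u u0; rewrite ImM ReJ ImJ wI wR => uI.
    by apply: (canLR (mulfK (lt0r_neq0 u0))); lra.
  have mpar : is_min_param (fun n => d n.+1) m.
    split; last exact: (minpar0 v0 W_neq0 WS rho0 rho_rec).
    split=> [|[//|n] _|//].
      by rewrite /m (minpar0 v0 W_neq0 WS rho0 rho_rec) lexx ltr01.
    by rewrite /m (minpar_gt0 v0 v_lt1 WW W_neq0 WS rho0 rho_rec)
      (minpar_lt1 v0 v_lt1 WW W_neq0 WS rho0 rho_rec).
  have sp := sppcs_divergent_sum mpar
    (kerf_sqr_gt0 mu_circle mu_nontrivial mu_no_atom_at_1 S_opuc ww)
    (minpar_step v0 v_lt1 WW W_neq0 WS e_neq0 eS rho0 rho_rec sE).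
  exists c, d, m; split.
    have wJ0 : w^* != 0 by rewrite -W0 conjC_eq0.
    have -> : (rho 0%N + 1) / (rho 0%N - 1) = w - w^*.
      by rewrite rho0 W0 cayley_ratio.
    rewrite c1E -complexiE; apply: complex_ext.
      by rewrite !(ReM, ImM, ReD, ImD, ReN, ImN, ReJ, ImJ) /=; ring.
    by rewrite !(ReM, ImM, ReD, ImD, ReN, ImN, ReJ, ImJ) /=; ring.
  split; first exact: c1E.
  split; first by case.
  split; first by case.
  split; first by move=> n; exact: (minparE v0 v_lt1 WW W_neq0 WS rho0 rho_rec).
  split; first exact: (para_first v0 v_lt1 WW W_neq0 WS rho0 rho_rec S0 R0 RnE).
  split.
    case=> // n _.
    exact: (para_recurrence v0 v_lt1 WW W_neq0 WS rho0 rho_rec S0 R0 P_S P_R n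
      RnE).
  split; first by exists m; case: mpar.
  split; first by [].
  have dich C : (forall n, \sum_(k < n) s k <= C) -> _ := fun sC => conj
    (bounded_sqdist1V_integrable mu_circle mu_nontrivial mu_no_atom_at_1 S_opuc
      kI sC)
    (bounded_parameter_eq0 mu_circle mu_nontrivial mu_no_atom_at_1 S_opuc kI
      sC).
  split=> [t0|t0].
    by apply/sp => -[C /dich[_ t0']]; rewrite t0' eqxx in t0.
  have JE : cintegrable mu (@unit_circle R)
      (fun z => z * (z - 1)^-1 * (1 - z)^-1) <->
      mu.-integrable (@unit_circle R) (fun z : borelC R => (sqdist1V z)%:E).
    split=> [[JR _]|iJ].
      apply: eq_integrable JR; first exact: measurable_circle.
      by move=> z; rewrite inE => Tz; rewrite J_integrandE.
    split; [apply: eq_integrable iJ|apply: eq_integrable (integrable0 _ _)];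
      try exact: measurable_circle;
      by move=> z; rewrite inE => Tz; rewrite J_integrandE.
  rewrite JE sp; split=> [/contrapT [C /dich[]] //|iJ]; apply.
  exact: (kerf_sqr_summable mu_circle mu_nontrivial mu_no_atom_at_1 S_opuc kI
    t0 iJ).
- move=> l [p [n lE]]; rewrite /pv_exists (laurent_trunc mu lE).
  exact: cvgP (cvg_pv_laurent mu_no_atom_at_1 (p := p) (m := n) kI).
- move=> d1 N d10 NE n k kn.
  have lE z : z != 0 -> z ^ (k%:Z - n%:Z) * (Rn n).[z] = (Rn n).[z] / z ^+ (n -
    k).
    by move=> z0; rewrite -opprB subzn ?(ltnW kn) // -invr_expz -exprnP mulrC.
  have /NE : laurent_poly (fun z => z ^ (k%:Z - n%:Z) * (Rn n).[z]).
    by exists (Rn n), (n - k)%N.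
  rewrite exp1rz mul1r.
  have := cvg_pv_laurent mu_no_atom_at_1 (p := Rn n) (m := (n - k)%N) kI.
  rewrite -(laurent_trunc mu lE) => /pv_integralE ->.
  (* The term i t l(1) moves [kerf] from I to w. Then [orth] applies with m = n - k - 1, as z^(k-n)
     is z^-(m+1). *)
  rewrite addrAC -kerf_shift -[(n - k)%N]prednK ?subn_gt0 //.
  rewrite orth; last by rewrite prednK ?subn_gt0 // leq_subr.
  move=> /eqP; rewrite mulf_eq0 => /orP[|/eqP //].
  rewrite -(rmorph0 (real_complex R)) => /eqP/complexI/eqP.
  rewrite mulf_eq0 invr_eq0 mulf_eq0 pnatr_eq0 (negPf d10) /= orbF gt_eqF //.
  by rewrite ltr_wpDr // mulr_ge0 ?sqr_ge0.
Qed.
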